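(* Let $P$ be a stationary locally square integrable point process on $\mathbb R$ which is hyperuniform in the sense that $$\frac{\mathrm{Var}\bigl(\sum_{x\in P}f(R^{-1}x)\bigr)}{R}\xrightarrow[R\to\infty]{}0$$ for some Schwartz function $f$ with $\int_{\mathbb R}f\ne0$, and suppose that $P$ is not (linearly) $1$-rigid on some bounded measurable set $A\subset\mathbb R$. Then $$\int_{\mathbb R}|t|^3\,|\mathsf C|(dt)=\infty\quad\text{or}\quad\int_{\mathbb R}t^2\,\mathsf C(dt)\ne0,$$ where $\mathsf C$ is the correlation measure of $P$ and $|\mathsf C|$ its total variation measure.
   Context: Let $I_P(f)=\int f\,dP$. The correlation measure $\mathsf C$ is characterized by $\mathrm{Cov}(I_P(f),I_P(g))=\int\int f(y)g(x+y)\,\mathsf C(dx)\,dy$ for bounded measurable compactly supported $f,g$. For $k\in\{0,1,2,\dots\}$, $P$ is linearly $k$-rigid on a bounded measurable set $A$ if for every integer $0\le j\le k$, with $\gamma_j(t)=t^j1_A(t)$, $\inf_h\mathrm{Var}(I_P(\gamma_j)-I_P(h))=0$, the infimum being over bounded measurable compactly supported $h$ vanishing on $A$. *)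

(* Defs.v *)
From HB Require Import structures.
From mathcomp Require Import all_boot all_order all_algebra.
From mathcomp Require Import all_classical all_reals all_analysis.
From mathcomp Require Import measurable_realfun.

Set Implicit Arguments.
Unset Strict Implicit.
Unset Printing Implicit Defensive.

Import Order.TTheory GRing.Theory Num.Theory.
Import numFieldNormedType.Exports.

Local Open Scope classical_set_scope.
Local Open Scope ring_scope.

Section test_functions.
Context {R : realType}.
Implicit Types f h : R -> R.

Definition test_function h :=
  [/\ measurable_fun [set: R] h, bounded_fun h
    & compact (closure [set x | h x != 0])].

Definition schwartz f :=
  (forall (n : nat) (x : R), derivable (f^`(n))%classic x 1) /\
  (forall m n : nat, exists M : R, forall x : R, `|x ^+ m * (f^`(n))%classic x| <= M).

End test_functions.

(* A locally finite signed measure on the line is in general not a charge: its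
   positive and negative parts may both have infinite total mass (for the
   randomly shifted lattice, C is the counting measure on the integers minus the
   Lebesgue measure).  It is therefore given by its Jordan decomposition: two
   locally finite measures concentrated on complementary sets. *)
Record signed_radon_measure (R : realType) := SignedRadonMeasure {
  srm_pos : {measure set (measurableTypeR R) -> \bar R} ;
  srm_neg : {measure set (measurableTypeR R) -> \bar R} ;
  srm_pos_lfin : forall B : set R, measurable B -> bounded_set B ->
    (srm_pos B < +oo)%E ;
  srm_neg_lfin : forall B : set R, measurable B -> bounded_set B ->
    (srm_neg B < +oo)%E ;
  srm_hahn : exists D : set R,
    [/\ measurable D, srm_pos (~` D) = 0%E & srm_neg D = 0%E] }.

Section signed_radon_measure.
Context {R : realType}.
Implicit Types (C : signed_radon_measure R) (f : R -> R).

Definition srm_total_variation C : {measure set (measurableTypeR R) -> \bar R} :=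
  measure_add (srm_pos C) (srm_neg C).

(* Meaningful when f is integrable for the total variation of C. *)
Definition srm_integral C f : \bar R :=
  (\int[srm_pos C]_x (f x)%:E - \int[srm_neg C]_x (f x)%:E)%E.

End signed_radon_measure.

Section point_process.
Context {R : realType} {d : measure_display} {Omega : measurableType d}.
Variable Pr : probability Omega R.
Implicit Types (P : R.-ker Omega ~> measurableTypeR R) (f g h : R -> R).

(* A configuration is encoded by its counting measure P w, so that the sum of
   f over the points of P, counted with multiplicity, is the integral of f with
   respect to P w.  Being a kernel says that the counts P w B are random
   variables. *)
Definition point_process P :=
  forall (w : Omega) (B : set R), measurable B -> bounded_set B ->
    exists n : nat, P w B = n%:R%:E.

Definition linstat P f : Omega -> R := fun w => \int[P w]_x f x.

(* The sigma-algebra on configurations generated by the counts mu |-> mu B. *)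
Definition configuration_measurable : set (set (set R -> \bar R)) :=
  <<s [set E | exists B : set R, exists U : set (\bar R),
        [/\ measurable B, measurable U & E = [set mu | U (mu B)]]] >>.

Definition stationary P :=
  forall (a : R) (E : set (set R -> \bar R)), configuration_measurable E ->
    Pr [set w | E (pushforward (P w) (fun x => x + a))] = Pr [set w | E (P w)].

Definition locally_square_integrable P :=
  forall B : set R, measurable B -> bounded_set B ->
    (\int[Pr]_w (P w B ^+ 2) < +oo)%E.

Definition correlation_measure P (C : signed_radon_measure R) :=
  forall f g, test_function f -> test_function g ->
    covariance Pr (linstat P f) (linstat P g) =
    (\int[lebesgue_measure]_y srm_integral C (fun x => (f y * g (x + y))%R))%E.

(* For Schwartz f, E[|f|(P)] < +oo, so the sum defining linstat P f converges
   absolutely almost surely. *)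
Definition hyperuniform P :=
  exists f, [/\ schwartz f, \int[lebesgue_measure]_x f x != 0
    & ('V_Pr[(linstat P (fun x => f (r^-1 * x)))%R] * (r^-1)%:E)%E
        @[r --> +oo%R] --> 0%E].

Definition linearly_rigid P (k : nat) (A : set R) :=
  forall j : nat, (j <= k)%N ->
    ereal_inf
      [set 'V_Pr[(linstat P (fun t => t ^+ j * \1_A t) \- linstat P h)%R]%E
      | h in [set h | test_function h /\ {in A, forall x, h x = 0}]]
    = 0%E.

End point_process.

(* Main.v *)
Require Import Defs.
From HB Require Import structures.
From mathcomp Require Import all_boot all_order all_algebra.
From mathcomp Require Import all_classical all_reals all_analysis.
From mathcomp Require Import measurable_realfun.
From mathcomp Require Import ring lra.

(** The proof is by contraposition: if [C] has a finite third absolute moment and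
    a vanishing second moment, then the process is 1-rigid on every bounded
    measurable set.

    For a test function f, Fubini turns the covariance formula into
    Var (I f) = C(rho_f), the integral against C of the autocorrelation
    rho_f(x), the integral of f(y) f(x+y) dy ([variance_energy]). The finite
    third moment makes C a finite signed measure, so this quadratic form is
    controlled by sup norms and L1 norms of f ([energy_le]).

    Hyperuniformity forces C to have total mass zero ([total_mass_eq0]). For a
    slowly varying function f_r(x) = f(x/r), the autocorrelation stays within a
    bounded error of rho_{f_r}(0), the squared L2 norm of f_r, which grows like
    r; hence Var (I f_r) differs from C(R) rho_{f_r}(0) by O(1), and dividing by
    r leaves C(R) = 0. A Schwartz function is not a test function, so it is first
    cut off; the variance of the discarded tail is small by Fatou's lemma
    ([variance_truncation_le]), for which stationarity provides the finiteness
    of the mean of I(|f_r|) ([mean_decay_lty]).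

    For the rigidity, consider the trial functions
    g_r(x) = x^j (1 - x^2/r^2)_+^2 with j = 0 or 1. Centring the autocorrelation,
    rho_g(2u) is the integral of g(y-u) g(y+u) dy, and the integrand is even in u:
    it equals a(y) + b(y) u^2 up to a remainder of fourth order. Therefore
    rho_{g_r}(x) = alpha_r + beta_r x^2 + err_r(x) with |err_r(x)| <= 16 |x|^3
    uniformly in r and err_r(x) tending to 0 for fixed x. The first two terms
    integrate to 0 against C whatever the size of alpha_r and beta_r, and
    dominated convergence, with the third moment as dominating integral, kills
    the last one: Var (I g_r) tends to 0 ([trial_energy_cvg]). This is where the
    exponent 3 comes from: for j = 1 the main terms of rho_{g_r} have size r^3 and
    r, and a trial function with corners would leave an error in |x|^3 of order
    one, without decay in r.

    Finally g_r is close to x^j on A, so g_r can be corrected on A to agree with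
    x^j there, at a vanishing cost in variance; outside A it is the statistic
    -I(h) of an admissible h ([rigid_of_vanishing_moments]). *)

Set Implicit Arguments.
Unset Strict Implicit.
Unset Printing Implicit Defensive.

Import Order.TTheory GRing.Theory Num.Theory.
Import numFieldNormedType.Exports.

Local Open Scope classical_set_scope.
Local Open Scope ring_scope.

(** * Test functions *)

Section test_function_toolkit.
Context {R : realType}.
Implicit Types (f g h : R -> R) (b r : R).

(** A form that is easier to establish and to use than compactness of the closure
    of the support. *)
Lemma test_functionP h : test_function h <->
  measurable_fun setT h /\
  exists b r, forall x, `|h x| <= b /\ (r < `|x| -> h x = 0).
Proof.
split=> [[mh [M [_ bM]] ch]|[mh [b [r hbr]]]].
  split=> //.
  have [r [_ br]] := compact_bounded ch.
  exists (`|M| + 1), (`|r| + 1) => x; split.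
    by apply: bM => //; rewrite ltr_pwDr// ler_norm.
  move=> rx; apply/eqP; apply: contraTT rx => hx; rewrite -leNgt.
  apply: (br (`|r| + 1)); first by rewrite ltr_pwDr// ler_norm.
  exact: subset_closure.
split=> //.
  exists b; split; first exact: num_real.
  by move=> c bc x _ /=; rewrite (le_trans (hbr x).1)// ltW.
apply: (@subclosed_compact _ _ `[- r, r]%classic).
- exact: closed_closure.
- exact: segment_compact.
have /closure_id -> : closed `[- r, r]%classic by exact: interval_closed.
apply: closureS => y /= hy; rewrite in_itv/= -ler_norml leNgt.
by apply/negP => /(hbr y).2 h0; rewrite h0 eqxx in hy.
Qed.

Lemma test_function_measurable h : test_function h -> measurable_fun setT h.
Proof. by case. Qed.

Lemma test_function_bound h : test_function h ->
  exists b r, [/\ 0 <= b, 0 <= r,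
    (forall x, `|h x| <= b) & forall x, r < `|x| -> h x = 0].
Proof.
move=> /test_functionP[_ [b [r hbr]]]; exists b, `|r|; split=> //.
- by rewrite (le_trans _ (hbr 0).1).
- by move=> x; exact: (hbr x).1.
- by move=> x rx; apply: (hbr x).2; exact: le_lt_trans (ler_norm r) rx.
Qed.

Lemma test_functionD f g : test_function f -> test_function g ->
  test_function (fun x => f x + g x).
Proof.
move=> tf tg; apply/test_functionP; split.
  by apply: measurable_funD; exact: test_function_measurable.
have [b [r [b0 r0 fb fr]]] := test_function_bound tf.
have [c [s [c0 s0 gc gs]]] := test_function_bound tg.
exists (b + c), (r + s) => x; split.
  by rewrite (le_trans (ler_normD _ _))// lerD.
by move=> rsx; rewrite fr ?gs ?addr0// (le_lt_trans _ rsx)// ?lerDl ?lerDr.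
Qed.

Lemma test_functionN f : test_function f -> test_function (fun x => - f x).
Proof.
move=> tf; apply/test_functionP; split.
  by apply: measurableT_comp => //; exact: test_function_measurable.
have [b [r [b0 r0 fb fr]]] := test_function_bound tf.
by exists b, r => x; rewrite normrN; split=> // /fr ->; rewrite oppr0.
Qed.

Lemma test_functionB f g : test_function f -> test_function g ->
  test_function (fun x => f x - g x).
Proof. by move=> tf tg; apply: test_functionD => //; exact: test_functionN. Qed.

Lemma test_function_le f g : measurable_fun setT f -> test_function g ->
  (forall x, `|f x| <= `|g x|) -> test_function f.
Proof.
move=> mf tg fg; apply/test_functionP; split=> //.
have [b [r [b0 r0 gb gr]]] := test_function_bound tg.
exists b, r => x; split; first exact: le_trans (fg x) (gb x).
by move=> /gr gx; move: (fg x); rewrite gx normr0 normr_le0 => /eqP.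
Qed.

Lemma test_function_restrict f (A : set R) : measurable A -> test_function f ->
  test_function (fun x => f x * \1_A x).
Proof.
move=> mA tf; apply: test_function_le (tf) _ => [|x].
  apply: measurable_funM; first exact: test_function_measurable.
  exact: measurable_indic.
by rewrite normrM indicE; case: (x \in A); rewrite ?normr1 ?normr0 ?mulr1 ?mulr0.
Qed.

Lemma test_function_monomial (A : set R) j : measurable A -> bounded_set A ->
  test_function (fun t => t ^+ j * \1_A t).
Proof.
move=> mA [M [_ AM]]; apply/test_functionP; split.
  by apply: measurable_funM => //; exact: measurable_indic.
exists ((`|M| + 1) ^+ j), (`|M| + 1) => x.
rewrite indicE; case: (boolP (x \in A)) => [/set_mem Ax|_].
  have xM : `|x| <= `|M| + 1 by apply: AM Ax; rewrite ltr_pwDr ?ler_norm.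
  split; last by rewrite ltNge xM.
  by rewrite mulr1 normrX lerXn2r// ?nnegrE// addr_ge0.
by rewrite mulr0 normr0; split=> //; rewrite exprn_ge0// addr_ge0.
Qed.

Lemma bounded_set_itvcc (a b : R) : bounded_set `[a, b]%classic.
Proof. by apply: compact_bounded; exact: segment_compact. Qed.

Definition locally_finite (mu : set (measurableTypeR R) -> \bar R) :=
  forall B : set R, measurable B -> bounded_set B -> (mu B < +oo)%E.

Lemma locally_finite_lebesgue : locally_finite (@lebesgue_measure R).
Proof.
move=> B mB [M [_ BM]].
have /(le_measure lebesgue_measure) : B `<=` `[- (`|M| + 1), `|M| + 1]%classic.
  move=> x /BM; rewrite /= in_itv/= -ler_norml; apply.
  by rewrite ltr_pwDr// ler_norm.
move=> /(_ _ _)/le_lt_trans; apply; rewrite ?inE//.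
rewrite [X in (X < _)%E](lebesgue_measure_itv `[- (`|M| + 1), `|M| + 1]) /=.
by case: ifPn => // _; rewrite ltry.
Qed.

Lemma test_function_integrable
    (mu : {measure set (measurableTypeR R) -> \bar R}) h :
  locally_finite mu -> test_function h -> mu.-integrable setT (EFin \o h).
Proof.
move=> lf th; have [b [r [b0 r0 hb hr]]] := test_function_bound th.
have mh := test_function_measurable th.
have mI : measurable (`[- r, r]%classic : set (measurableTypeR R)) by [].
have hI : mu.-integrable (`[- r, r]%classic : set (measurableTypeR R)) (EFin \o h).
  apply: measurable_bounded_integrable => //.
  - by apply: lf => //; exact: bounded_set_itvcc.
  - exact: measurable_funTS.
  - exists b; split; first exact: num_real.
    by move=> c bc x _ /=; rewrite (le_trans (hb x))// ltW.
have := (integrable_mkcond _ mI).1 hI; congr (_.-integrable _ _).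
apply/funext => x; rewrite patchE; case: ifPn => //.
rewrite notin_setE/= in_itv/= -ler_norml => /negP; rewrite -ltNge => rx.
by rewrite /= hr.
Qed.

Lemma test_function_integrable_lebesgue h : test_function h ->
  lebesgue_measure.-integrable setT (EFin \o h).
Proof. by move=> /test_function_integrable; apply; exact: locally_finite_lebesgue. Qed.

End test_function_toolkit.

(** * Translation invariance of the Lebesgue integral *)

Section lebesgue_translation.
Context {R : realType}.
Local Notation leb := (@lebesgue_measure R).

Lemma lebesgue_measure_shift (a : R) (A : set R) : measurable A ->
  pushforward leb ((fun x => x + a) : _ -> measurableTypeR R) A = leb A.
Proof.
have mshift : measurable_fun [set: measurableTypeR R]
    ((fun x => x + a) : measurableTypeR R -> measurableTypeR R).
  exact: measurable_funD.
move=> mA; apply/esym/lebesgue_measure_unique => //= _ [[u v]] _ <-.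
rewrite /pushforward.
have -> : (fun x => x + a) @^-1` `]u, v]%classic = `]u - a, v - a]%classic.
  by apply/seteqP; split => x /=; rewrite !in_itv/= ltrBlDr lerBrDr.
by rewrite !lebesgue_measure_itv/= !lte_fin ltrD2r -!EFinB opprB addrA subrK.
Qed.

Lemma Rintegral_shift (a : R) (f : R -> R) :
  leb.-integrable setT (EFin \o f) ->
  \int[leb]_x f (x + a) = \int[leb]_x f x.
Proof.
move=> fi; have /measurable_EFinP mf := measurable_int _ fi.
have mshift : measurable_fun [set: measurableTypeR R]
    ((fun x => x + a) : measurableTypeR R -> measurableTypeR R).
  exact: measurable_funD.
have pushE A : measurable A -> A `<=` setT ->
    pushforward leb ((fun x => x + a) : _ -> measurableTypeR R) A = leb A.
  by move=> mA _; exact: lebesgue_measure_shift.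
congr fine; rewrite -[RHS](eq_measure_integral _ pushE).
rewrite (integral_pushforward mshift)//.
  exact/measurable_EFinP.
apply/integrableP; split.
  by apply/measurable_EFinP; apply: (measurableT_comp mf).
have /integrableP[_] := fi; rewrite -(eq_measure_integral _ pushE).
rewrite ge0_integral_pushforward//=.
by apply/measurable_EFinP; apply: measurableT_comp.
Qed.

End lebesgue_translation.

(** * Integration against a signed Radon measure *)

Section signed_integral.
Context {R : realType} (C : signed_radon_measure R).
Implicit Types (f g : R -> R).
Local Notation tv := (srm_total_variation C).

Definition sint f : R := \int[srm_pos C]_x f x - \int[srm_neg C]_x f x.

Lemma tvE (A : set R) : tv A = (srm_pos C A + srm_neg C A)%E.
Proof. exact: measure_addE. Qed.

Lemma tv_integral (f : R -> \bar R) : measurable_fun setT f ->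
  (forall x, (0 <= f x)%E) ->
  (\int[tv]_x f x = \int[srm_pos C]_x f x + \int[srm_neg C]_x f x)%E.
Proof. by move=> mf f0; rewrite ge0_integral_measure_add. Qed.

Lemma tv_integrable f : tv.-integrable setT (EFin \o f) ->
  (srm_pos C).-integrable setT (EFin \o f) /\
  (srm_neg C).-integrable setT (EFin \o f).
Proof.
move=> /integrableP[mf]; rewrite tv_integral//; last exact: measurableT_comp.
move=> foo; split; apply/integrableP; split => //;
  apply: le_lt_trans foo; [rewrite leeDl//|rewrite leeDr//];
  exact: integral_ge0.
Qed.

Lemma sintD f g : tv.-integrable setT (EFin \o f) ->
  tv.-integrable setT (EFin \o g) -> sint (fun x => f x + g x) = sint f + sint g.
Proof.
move=> /tv_integrable[fp fn] /tv_integrable[gp gn].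
by rewrite /sint !RintegralD// opprD addrACA.
Qed.

Lemma sintZ k f : tv.-integrable setT (EFin \o f) ->
  sint (fun x => k * f x) = k * sint f.
Proof. by move=> /tv_integrable[fp fn]; rewrite /sint !RintegralZl// mulrBr. Qed.

Lemma sintB f g : tv.-integrable setT (EFin \o f) ->
  tv.-integrable setT (EFin \o g) -> sint (fun x => f x - g x) = sint f - sint g.
Proof.
move=> /tv_integrable[fp fn] /tv_integrable[gp gn].
by rewrite /sint !RintegralB//; ring.
Qed.

(** The total variation dominates, so that estimates and dominated convergence
    can be carried out with the single positive measure [tv]. *)
Lemma le_normr_sint f : tv.-integrable setT (EFin \o f) ->
  `|sint f| <= \int[tv]_x `|f x|.
Proof.
move=> fi; have [fp fn] := tv_integrable fi.
have /measurable_EFinP mf := measurable_int _ fi.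
have -> : \int[tv]_x `|f x| =
    \int[srm_pos C]_x `|f x| + \int[srm_neg C]_x `|f x|.
  rewrite /Rintegral tv_integral//; last first.
    by apply/measurable_EFinP; apply: measurableT_comp.
  rewrite fineD//.
  - exact: integrable_fin_num (integrable_norm fp).
  - exact: integrable_fin_num (integrable_norm fn).
rewrite (le_trans (ler_normB _ _))// lerD//; exact: le_normr_Rintegral.
Qed.

Lemma srm_integralE f : tv.-integrable setT (EFin \o f) ->
  srm_integral C f = (sint f)%:E.
Proof.
move=> /tv_integrable[fp fn]; rewrite /sint /Rintegral EFinB.
by rewrite !fineK//; exact: integrable_fin_num.
Qed.

End signed_integral.

(** * Autocorrelations *)

Section autocorrelation.
Context {R : realType}.
Implicit Types (f g : R -> R).
Local Notation leb := (@lebesgue_measure R).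

Definition autocorr f (x : R) : R := \int[leb]_y (f y * f (x + y)).

Lemma test_function_shift f a : test_function f ->
  test_function (fun x => f (a + x)).
Proof.
move=> tf; apply/test_functionP; split.
  by apply: measurableT_comp (test_function_measurable tf) _; exact: measurable_funD.
have [b [r [b0 r0 fb fr]]] := test_function_bound tf.
exists b, (r + `|a|) => x; split=> // rax; apply: fr.
by have := ler_normB (a + x) a; rewrite [X in `|X|]addrAC subrr add0r; lra.
Qed.

Lemma test_functionM f g : test_function f -> test_function g ->
  test_function (fun x => f x * g x).
Proof.
move=> tf tg; apply/test_functionP; split.
  by apply: measurable_funM; exact: test_function_measurable.
have [b [r [b0 r0 fb fr]]] := test_function_bound tf.
have [c [s [c0 s0 gc gs]]] := test_function_bound tg.
exists (b * c), r => x; split; first by rewrite normrM ler_pM.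
by move=> /fr ->; rewrite mul0r.
Qed.

Lemma autocorr_integrand_integrable f x : test_function f ->
  leb.-integrable setT (EFin \o (fun y => f y * f (x + y))).
Proof.
move=> tf; apply: test_function_integrable_lebesgue.
by apply: test_functionM => //; exact: test_function_shift.
Qed.

Lemma measurable_autocorr_integrand f : measurable_fun setT f ->
  measurable_fun [set: measurableTypeR R * measurableTypeR R]
    (fun p => f p.2 * f (p.1 + p.2)).
Proof.
move=> mf; apply: measurable_funM.
  exact: measurableT_comp mf (@measurable_snd _ _ (measurableTypeR R) (measurableTypeR R)).
apply: (measurableT_comp mf); apply: measurable_funD; first exact: measurable_fst.
exact: measurable_snd.
Qed.

Lemma le_autocorr f (b : R) x : test_function f -> (forall y, `|f y| <= b) ->
  `|autocorr f x| <= b * \int[leb]_y `|f y|.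
Proof.
move=> tf fb; have fi := autocorr_integrand_integrable x tf.
rewrite (le_trans (le_normr_Rintegral _ fi))//.
have nfi := integrable_norm (test_function_integrable_lebesgue tf).
rewrite -RintegralZl//; apply: le_Rintegral => //.
- exact: (integrable_norm fi).
- exact: (integrableZl _ b nfi).
- by move=> y _; rewrite normrM mulrC ler_wpM2r.
Qed.

Section autocorr_Fubini.
Variable mu : {finite_measure set (measurableTypeR R) -> \bar R}.

Let autocorr_integrand_lty f : test_function f ->
  (\int[mu]_x \int[leb]_y `|(f y * f (x + y))%:E| < +oo)%E.
Proof.
move=> tf; have [b [r [b0 r0 fb fr]]] := test_function_bound tf.
have mF := measurable_autocorr_integrand (test_function_measurable tf).
pose K := b * \int[leb]_y `|f y|.
have K0 : 0 <= K by rewrite mulr_ge0// Rintegral_ge0.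
apply: (@le_lt_trans _ _ (\int[mu]_x (K%:E))%E); last first.
  by rewrite integral_cst// lte_mul_pinfty// ltey_eq fin_num_measure.
apply: ge0_le_integral => //.
- by move=> x _; exact: integral_ge0.
- apply: (measurable_fun_fubini_tonelli_F (m2 := leb)
    (fun p : measurableTypeR R * measurableTypeR R =>
      `|(f p.2 * f (p.1 + p.2))%:E|%E)) => //=.
  by apply/measurable_EFinP; exact: measurableT_comp.
- move=> x _ /=.
  have nfi := integrable_norm (autocorr_integrand_integrable x tf).
  have := integrable_fin_num measurableT nfi => /fineK <-; rewrite lee_fin.
  have gi := integrable_norm (test_function_integrable_lebesgue tf).
  rewrite /K -RintegralZl//; apply: le_Rintegral => //.
    exact: (integrableZl _ b gi).
  by move=> y _ /=; rewrite normrM mulrC ler_wpM2r.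
Qed.

(** The roles of the two measures are exchanged to get the integrability of
    both iterated integrals. *)
Lemma autocorr_Fubini f : test_function f ->
  [/\ mu.-integrable setT (EFin \o autocorr f),
    leb.-integrable setT (fun y => (\int[mu]_x (f y * f (x + y))%:E)%E) &
    (\int[leb]_y \int[mu]_x (f y * f (x + y))%:E =
     \int[mu]_x (autocorr f x)%:E)%E].
Proof.
move=> tf; have Foo := autocorr_integrand_lty tf.
have mF := measurable_autocorr_integrand (test_function_measurable tf).
pose F (p : measurableTypeR R * measurableTypeR R) : \bar R :=
  (f p.2 * f (p.1 + p.2))%:E.
pose G (p : measurableTypeR R * measurableTypeR R) : \bar R :=
  (f p.1 * f (p.2 + p.1))%:E.
have Fi : (mu \x leb)%E.-integrable setT F.
  by apply/(integrable12ltyP mu leb) => //; exact/measurable_EFinP.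
have Gi : (leb \x mu)%E.-integrable setT G.
  apply/(integrable21ltyP leb mu) => //; apply/measurable_EFinP.
  exact: (measurableT_comp mF
    (@measurable_swap _ _ (measurableTypeR R) (measurableTypeR R))).
have acE x : (\int[leb]_y (f y * f (x + y))%:E)%E = (autocorr f x)%:E.
  rewrite /autocorr /Rintegral fineK//.
  exact: integrable_fin_num (autocorr_integrand_integrable x tf).
split.
- by have := integrable_fubini_F Fi; apply: eq_integrable => // x _; exact: acE.
- exact: integrable_fubini_F Gi.
- by rewrite -(Fubini Fi); apply: eq_integral => x _; exact: acE.
Qed.

End autocorr_Fubini.
End autocorrelation.

(** * Correlation measures with a finite third moment *)

(** A measure with finite values, repackaged with its finiteness so that it
    can be multiplied with the Lebesgue measure. *)
Definition finite_copy {d} {T : measurableType d} {R : realType}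
    (mu : {measure set T -> \bar R}) (mufin : fin_num_fun mu) :
  set T -> \bar R := mu.

Section finite_copy_instance.
Context {d} {T : measurableType d} {R : realType}.
Variables (mu : {measure set T -> \bar R}) (mufin : fin_num_fun mu).

HB.instance Definition _ := Measure.on (finite_copy mufin).

HB.instance Definition _ :=
  @Measure_isFinite.Build d T R (finite_copy mufin) mufin.

End finite_copy_instance.

Section finite_third_moment.
Context {R : realType} (C : signed_radon_measure R).
Implicit Types (f g : R -> R).
Local Notation tv := (srm_total_variation C).
Local Notation leb := (@lebesgue_measure R).
Hypothesis moment3 : (\int[tv]_t (`|t| ^+ 3)%:E < +oo)%E.

(** Local finiteness controls the mass near 0, the third moment controls it away
    from 0. *)
Let tv_setT_lty : (tv setT < +oo)%E.
Proof.
pose I := `[- 1, 1]%classic : set R.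
have mI : measurable I := measurable_itv _.
have bI : bounded_set I := @bounded_set_itvcc R _ _.
have tvI : (tv I < +oo)%E.
  rewrite tvE lte_add_pinfty//.
  - by apply: srm_pos_lfin.
  - by apply: srm_neg_lfin.
have mcube : measurable_fun [set: measurableTypeR R] (fun t : R => `|t| ^+ 3).
  by apply: measurable_funX; exact: normr_measurable.
rewrite -[tv setT]mul1e -integral_cst//.
apply: (@le_lt_trans _ _
    (\int[tv]_t ((\1_I t)%:E + (`|t| ^+ 3)%:E))%E).
  apply: ge0_le_integral => //.
  - apply: emeasurable_funD; apply/measurable_EFinP => //.
  - move=> t _; rewrite -EFinD lee_fin indicE.
    case: (boolP (t \in I)) => [_|]; first by rewrite lerDl exprn_ge0.
    rewrite notin_setE /I /= in_itv/= -ler_norml => /negP; rewrite -ltNge => t1.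
    by rewrite add0r exprn_ege1// ltW.
rewrite ge0_integralD//; first by rewrite integral_indic// setIT lte_add_pinfty.
- by apply/measurable_EFinP; exact: measurable_indic.
- exact/measurable_EFinP.
Qed.

Lemma tv_integrable_cubic f (K : R) : measurable_fun setT f ->
  (forall t, `|f t| <= K * (1 + `|t| ^+ 3)) ->
  tv.-integrable setT (EFin \o f).
Proof.
move=> mf fK.
have mcube : measurable_fun [set: measurableTypeR R] (fun t : R => `|t| ^+ 3).
  by apply: measurable_funX; exact: normr_measurable.
have i1 : tv.-integrable setT (EFin \o cst (1 : R)).
  apply/integrableP; split => //; first exact/measurable_EFinP.
  under eq_integral do rewrite /= normr1.
  by rewrite (integral_cst tv measurableT 1%E) mul1e.
have i3 : tv.-integrable setT (EFin \o (fun t : R => `|t| ^+ 3)).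
  apply/integrableP; split => //; first exact/measurable_EFinP.
  by under eq_integral do rewrite /= ger0_norm ?exprn_ge0//.
have := integrableZl measurableT K (integrableD measurableT i1 i3).
apply: le_integrable => //; first exact/measurable_EFinP.
by move=> t _ /=; rewrite lee_fin (le_trans (fK t))// ler_norm.
Qed.

Lemma tv_integrable_bounded f (K : R) : measurable_fun setT f ->
  (forall t, `|f t| <= K) -> tv.-integrable setT (EFin \o f).
Proof.
move=> mf fK; apply: (@tv_integrable_cubic _ K) => // t.
rewrite (le_trans (fK t))// ler_peMr//.
  by rewrite (le_trans _ (fK 0)).
by rewrite lerDl exprn_ge0.
Qed.

Lemma tv_integrable_square : tv.-integrable setT (EFin \o (fun t : R => t ^+ 2)).
Proof.
apply: (@tv_integrable_cubic _ 1); first exact: measurable_funX.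
move=> t; rewrite mul1r normrX; have := normr_ge0 t.
move: (`|t|) => s s0; have [s1|/ltW s1] := leP s 1.
  by have := exprn_ile1 2 s0 s1; have := exprn_ge0 3 s0; lra.
by rewrite (le_trans (ler_weXn2l s1 (isT : (2 <= 3)%N)))// lerDr.
Qed.

Lemma srm_pos_fin : fin_num_fun (srm_pos C).
Proof.
move=> U mU; rewrite ge0_fin_numE//.
apply: (@le_lt_trans _ _ (srm_pos C setT)).
  by apply: le_measure; rewrite ?inE.
by apply: (le_lt_trans _ tv_setT_lty); rewrite tvE leeDl.
Qed.

Lemma srm_neg_fin : fin_num_fun (srm_neg C).
Proof.
move=> U mU; rewrite ge0_fin_numE//.
apply: (@le_lt_trans _ _ (srm_neg C setT)).
  by apply: le_measure; rewrite ?inE.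
by apply: (le_lt_trans _ tv_setT_lty); rewrite tvE leeDr.
Qed.

(** Both parts of [C] being finite, the order of integration can be exchanged
    in the covariance formula. *)
Lemma autocorr_correlation f : test_function f ->
  tv.-integrable setT (EFin \o autocorr f) /\
  (\int[leb]_y srm_integral C (fun x => (f y * f (x + y))%R))%E =
    (sint C (autocorr f))%:E.
Proof.
move=> tf.
have [mi1 mi2 mi3] := autocorr_Fubini (finite_copy srm_pos_fin) tf.
have [ni1 ni2 ni3] := autocorr_Fubini (finite_copy srm_neg_fin) tf.
have [b [r [b0 r0 fb fr]]] := test_function_bound tf.
have ti : tv.-integrable setT (EFin \o autocorr f).
  apply: (@tv_integrable_bounded _ (b * \int[leb]_y `|f y|)).
    by have /measurable_EFinP := measurable_int _ mi1.
  by move=> x; exact: le_autocorr.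
split=> //; rewrite -srm_integralE// /srm_integral.
by rewrite integralB// mi3 ni3.
Qed.

End finite_third_moment.

(** * Variances of truncated linear statistics *)

Lemma variance_integral {R : realType} {d} {T : measurableType d}
    (Pr : probability T R) (X : T -> R) :
  ('V_Pr[X] =
   \int[Pr]_w ((X w - fine (\int[Pr]_v (X v)%:E)) ^+ 2)%:E)%E.
Proof. by rewrite /variance unlock unlock. Qed.

Lemma limn_einf_le {R : realType} (u : nat -> \bar R) (V : \bar R) :
  (forall m, (u m <= V)%E) -> (limn_einf u <= V)%E.
Proof.
move=> uV; rewrite limn_einf_lim; apply: lime_le; first exact: is_cvg_einfs.
apply: nearW => m; apply: le_trans (uV m); apply: ereal_inf_lbound.
by exists m => /=.
Qed.

Section linear_statistics.
Context {R : realType} {d : measure_display} {Omega : measurableType d}.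
Variables (Pr : probability Omega R) (P : R.-ker Omega ~> measurableTypeR R).
Hypothesis Ppp : point_process P.
Implicit Types (f g : R -> R).

Lemma locally_finite_point_process w : locally_finite (P w).
Proof. by move=> B mB bB; have [n ->] := Ppp w mB bB; rewrite ltry. Qed.

Lemma linstatB f g w : test_function f -> test_function g ->
  linstat P (fun x => f x - g x) w = linstat P f w - linstat P g w.
Proof.
move=> tf tg; rewrite /linstat RintegralB//.
- exact: (test_function_integrable (locally_finite_point_process w) tf).
- exact: (test_function_integrable (locally_finite_point_process w) tg).
Qed.

Lemma measurable_integral_kernel (f : R -> \bar R) : measurable_fun setT f ->
  measurable_fun setT (fun w => (\int[P w]_x f x)%E).
Proof.
move=> mf; under eq_fun do rewrite integralE.
have mP U : measurable U -> measurable_fun [set: Omega] (P ^~ U).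
  by move=> mU; exact: measurable_kernel.
apply: emeasurable_funB; apply: measurable_fun_integral_kernel => //.
- exact: measurable_funepos.
- exact: measurable_funeneg.
Qed.

Lemma measurable_linstat f : measurable_fun setT f ->
  measurable_fun setT (linstat P f).
Proof.
move=> mf; apply: (measurableT_comp (@fine_measurable _ _ measurableT)) => //.
by apply: measurable_integral_kernel; exact/measurable_EFinP.
Qed.

(* The extended value matters: it is finite only almost surely when f is not
   compactly supported. *)
Let abs_stat f w : \bar R := (\int[P w]_x `|f x|%:E)%E.

Let measurable_abs_stat f : measurable_fun setT f ->
  measurable_fun setT (abs_stat f).
Proof.
move=> mf; apply: measurable_integral_kernel; apply/measurable_EFinP.
exact: measurableT_comp.
Qed.

Let linstat_le f g w : test_function f -> measurable_fun setT g ->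
  (forall x, `|f x| <= `|g x|) -> (`|(linstat P f w)%:E| <= abs_stat g w)%E.
Proof.
move=> tf mg fg; have lf := locally_finite_point_process w.
have fi := test_function_integrable lf tf.
rewrite /= EFin_normr_Rintegral//.
have mf : measurable_fun [set: measurableTypeR R] f := test_function_measurable tf.
apply: le_trans (le_abse_integral _ _ _) _ => //; first exact/measurable_EFinP.
apply: ge0_le_integral => //.
- by apply: measurableT_comp => //; exact/measurable_EFinP.
- by apply/measurable_EFinP; exact: measurableT_comp.
- by move=> x _; rewrite lee_fin.
Qed.

Section dominated_truncation.
Variables (k : nat -> R -> R) (f : R -> R).
Hypothesis tk : forall m, test_function (k m).
Hypothesis mf : measurable_fun setT f.
Hypothesis kf : forall m x, `|k m x| <= `|f x|.
Hypothesis k_cvg : forall x, k m x @[m --> \oo] --> f x.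
Hypothesis f_mean : (\int[Pr]_w abs_stat f w < +oo)%E.

Let abs_stat_integrable : Pr.-integrable setT (abs_stat f).
Proof.
apply/integrableP; split; first exact: measurable_abs_stat.
by under eq_integral do rewrite gee0_abs ?integral_ge0//.
Qed.

Let linstat_cvg : {ae Pr, forall w, linstat P (k m) w @[m --> \oo] --> linstat P f w}.
Proof.
have := integrable_ae measurableT abs_stat_integrable.
apply: filterS => w /(_ Logic.I) zw.
have fi : (P w).-integrable setT (EFin \o f).
  apply/integrableP; split; first exact/measurable_EFinP.
  by rewrite -ge0_fin_numE ?integral_ge0//.
have [] := @dominated_convergence _ _ _ (P w) _ measurableT
  (fun m => EFin \o k m) (EFin \o f) (fun x => `|f x|%:E).
- by move=> m; apply/measurable_EFinP; exact: test_function_measurable.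
- exact/measurable_EFinP.
- by apply: aeW => x _; apply: cvg_EFin; [exact: nearW|exact: k_cvg].
- exact: (integrable_norm fi).
- by apply: aeW => x m _; rewrite lee_fin.
move=> _ _; rewrite -(fineK (integrable_fin_num measurableT fi)) => /fine_cvg.
exact.
Qed.

Let linstat_dominated m w : (`|(linstat P (k m) w)%:E| <= abs_stat f w)%E.
Proof. by apply: linstat_le => //; exact: test_function_measurable. Qed.

Let linstat_integrable m : Pr.-integrable setT (EFin \o linstat P (k m)).
Proof.
apply: le_integrable abs_stat_integrable => //.
  apply/measurable_EFinP; apply: measurable_linstat.
  exact: test_function_measurable.
move=> w _; rewrite [leRHS]gee0_abs ?integral_ge0//; exact: linstat_dominated.
Qed.

Let mean m := fine (\int[Pr]_w (linstat P (k m) w)%:E)%E.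

Let mean_lim := fine (\int[Pr]_w (linstat P f w)%:E)%E.

Let mean_cvg : mean m @[m --> \oo] --> mean_lim.
Proof.
have [] := @dominated_convergence _ _ _ Pr _ measurableT
  (fun m => EFin \o linstat P (k m)) (EFin \o linstat P f) (abs_stat f).
- move=> m; apply/measurable_EFinP; apply: measurable_linstat.
  exact: test_function_measurable.
- by apply/measurable_EFinP; exact: measurable_linstat.
- apply: filterS linstat_cvg => w kw _.
  by apply: cvg_EFin; [exact: nearW|exact: kw].
- exact: abs_stat_integrable.
- by apply: aeW => w m _; exact: linstat_dominated.
move=> fi _; rewrite -(fineK (integrable_fin_num measurableT fi)) => /fine_cvg.
exact.
Qed.

(** The centred statistics of k n - k m converge almost surely to that of
    k n - f, so that Fatou's lemma bounds the variance of the latter; the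
    factor 2 comes from the square of a sum. *)
Lemma variance_truncation_le (n : nat) (V : R) :
  (forall m, (n <= m)%N ->
    ('V_Pr[linstat P (fun x => k n x - k m x)%R] <= V%:E)%E) ->
  ('V_Pr[linstat P (k n)] <= 2%:E * ('V_Pr[linstat P f] + V%:E))%E.
Proof.
move=> nV.
have mX m : measurable_fun setT (linstat P (k m)).
  by apply: measurable_linstat; exact: test_function_measurable.
have mXf : measurable_fun setT (linstat P f) by exact: measurable_linstat.
pose D m w : R := (linstat P (k n) w - linstat P (k m) w - (mean n - mean m)) ^+ 2.
pose L w : R := (linstat P (k n) w - linstat P f w - (mean n - mean_lim)) ^+ 2.
have mD m : measurable_fun setT (D m).
  apply: measurable_funX; apply: measurable_funB => //.
  exact: measurable_funB.
have mL : measurable_fun setT L.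
  apply: measurable_funX; apply: measurable_funB => //.
  exact: measurable_funB.
have DV m : (n <= m)%N -> (\int[Pr]_w (D m w)%:E <= V%:E)%E.
  move=> nm; apply: le_trans (nV _ nm); rewrite variance_integral.
  rewrite le_eqVlt; apply/orP; left; apply/eqP/eq_integral => w _; congr ((_ ^+ 2)%:E).
  rewrite linstatB//; congr (_ - _ - _).
  rewrite -fineB; [|exact: integrable_fin_num (linstat_integrable _)..].
  rewrite -integralB_EFin//; congr fine; apply: eq_integral => v _.
  by rewrite linstatB// EFinB.
have LV : (\int[Pr]_w (L w)%:E <= V%:E)%E.
  have mD' m : measurable_fun setT (fun w => (D (n + m)%N w)%:E).
    exact/measurable_EFinP.
  have D0 m w : setT w -> (0 <= (D (n + m)%N w)%:E)%E.
    by rewrite lee_fin sqr_ge0.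
  apply: le_trans (le_trans (fatou Pr measurableT mD' D0) _); last first.
    by apply: limn_einf_le => m; apply: DV; rewrite leq_addr.
  apply: ae_ge0_le_integral => //.
  - by move=> w _; rewrite lee_fin sqr_ge0.
  - exact/measurable_EFinP.
  - move=> w _; rewrite limn_einf_lim; apply: lime_ge; first exact: is_cvg_einfs.
    by apply: nearW => m; apply: le_ereal_inf_tmp => _ [i _ <-]; exact: D0.
  - apply: (emeasurable_fun_cvg
      (fun m w => einfs (fun i => (D (n + i)%N w)%:E) m)) => [m|w _].
      exact: measurable_fun_einfs.
    by rewrite limn_einf_lim; exact: is_cvg_einfs.
  apply: filterS linstat_cvg => w kw _.
  rewrite (_ : limn_einf _ = (L w)%:E)//; apply: (cvg_limn_einf_sup _).1.
  apply: cvg_EFin; first exact: nearW.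
  apply: (@cvg_comp _ _ _ (fun m => (n + m)%N) (D ^~ w)).
    exact: cvg_addnl.
  have DE : D ^~ w = (fun m => (linstat P (k n) w - linstat P (k m) w -
    (mean n - mean m)) * (linstat P (k n) w - linstat P (k m) w - (mean n - mean m))).
    by apply/funext => m; rewrite /D expr2.
  rewrite DE /L expr2.
  by apply: cvgM; apply: cvgB; (apply: cvgB; [exact: cvg_cst|]).
rewrite variance_integral.
apply: (@le_trans _ _ (\int[Pr]_w (2%:E *
    (((linstat P f w - mean_lim) ^+ 2)%:E + (L w)%:E)))%E).
  apply: ge0_le_integral => //.
  - by move=> w _; rewrite lee_fin sqr_ge0.
  - by apply/measurable_EFinP; apply: measurable_funX; exact: measurable_funB.
  - apply: measurable_funeM; apply: emeasurable_funD; apply/measurable_EFinP => //.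
    by apply: measurable_funX; exact: measurable_funB.
  - move=> w _; rewrite -EFinD -EFinM lee_fin /L -/(mean n).
    set a := linstat P f w - mean_lim; set b := linstat P (k n) w - mean n.
    have -> : linstat P (k n) w - linstat P f w - (mean n - mean_lim) = b - a.
      by rewrite /a /b; ring.
    rewrite -subr_ge0 (_ : _ - _ = (b - 2 * a) ^+ 2) ?sqr_ge0//; ring.
rewrite ge0_integralZl_EFin//.
- rewrite lee_pmul2l// ge0_integralD//.
  + by rewrite -variance_integral leeD2l.
  + by move=> w _; rewrite lee_fin sqr_ge0.
  + by apply/measurable_EFinP; apply: measurable_funX; exact: measurable_funB.
  + by move=> w _; rewrite lee_fin sqr_ge0.
  + exact/measurable_EFinP.
- by move=> w _; rewrite -EFinD lee_fin addr_ge0// sqr_ge0.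
- apply: emeasurable_funD; apply/measurable_EFinP => //.
  by apply: measurable_funX; exact: measurable_funB.
Qed.

End dominated_truncation.
End linear_statistics.

(** * Integrals of functions of quadratic decay *)

Section quadratic_decay.
Context {R : realType}.
Local Notation leb := (@lebesgue_measure R).

(** An upper bound of B / (1 + k ^ 2) whose series telescopes. *)
Definition decay_weight (B : R) (k : nat) : R :=
  4 * B * (k.+1%:R^-1 - k.+2%:R^-1).

Lemma decay_weight_ge0 B k : 0 <= B -> 0 <= decay_weight B k.
Proof.
move=> B0; rewrite /decay_weight mulr_ge0 ?mulr_ge0// subr_ge0.
by rewrite lef_pV2 ?posrE ?ltr0n// ler_nat.
Qed.

Lemma decay_weight_series B : 0 <= B ->
  (\sum_(0 <= k <oo) (decay_weight B k)%:E <= (4 * B)%:E)%E.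
Proof.
move=> B0; apply: lime_le.
  by apply: is_cvg_nneseries => k _ _; rewrite lee_fin decay_weight_ge0.
apply: nearW => n; rewrite sumEFin lee_fin /decay_weight -mulr_sumr.
have -> : \sum_(0 <= i < n) (i.+1%:R^-1 - i.+2%:R^-1) = 1 - n.+1%:R^-1 :> R.
  elim: n => [|n IHn]; first by rewrite big_geq// invr1 subrr.
  by rewrite big_nat_recr//= IHn addrA subrK.
by rewrite ler_piMr ?mulr_ge0// lerBlDr lerDl.
Qed.

(** The factor 4 in [decay_weight] is what makes
    (k + 1) (k + 2) <= 4 (1 + k ^ 2) hold for every k. *)
Lemma decay_weightP B (k : nat) (x y : R) : 0 <= B -> k%:R <= `|x| ->
  (1 + x ^+ 2) * `|y| <= B -> `|y| <= decay_weight B k.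
Proof.
move=> B0 kx yB; rewrite /decay_weight.
have k1 : (k.+1%:R : R) = 1 + k%:R by rewrite -natr1 addrC.
have k2 : (k.+2%:R : R) = 2 + k%:R by rewrite -natr1 k1; ring.
have k0 : 0 <= k%:R :> R by [].
have p1 : k.+1%:R != 0 :> R by rewrite pnatr_eq0.
have p2 : k.+2%:R != 0 :> R by rewrite pnatr_eq0.
have -> : 4 * B * (k.+1%:R^-1 - k.+2%:R^-1) = 4 * B / (k.+1%:R * k.+2%:R).
  rewrite (_ : _ - _ = (k.+2%:R - k.+1%:R) / (k.+1%:R * k.+2%:R)).
    by rewrite k1 k2 (_ : _ - _ = 1) ?mul1r//; ring.
  have gen (a b : R) : a != 0 -> b != 0 -> a^-1 - b^-1 = (b - a) / (a * b).
    by move=> a0 b0; field; rewrite ?a0 ?b0.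
  exact: gen.
rewrite ler_pdivlMr ?mulr_gt0 ?ltr0n// k1 k2.
have x2 : k%:R ^+ 2 <= x ^+ 2.
  by rewrite -[x ^+ 2]real_normK ?num_real// lerXn2r// nnegrE.
have y0 := normr_ge0 y.
apply: le_trans (_ : `|y| * (4 * (1 + x ^+ 2)) <= _); last by lra.
rewrite ler_wpM2l//; have := sqr_ge0 (k%:R - 1 / 2 : R); nra.
Qed.

Definition annulus_right (r : R) (k : nat) : set R :=
  `[k%:R * r, k.+1%:R * r]%classic.

Definition annulus_left (r : R) (k : nat) : set R :=
  `[- (k.+1%:R * r), - (k%:R * r)]%classic.

(** The annuli are covered by translates of a single interval of length r, so
    that the bound becomes a multiple of a convergent series for the Lebesgue
    measure as well as for the mean counts of a stationary process. *)
Lemma integral_le_annuli (mu : {measure set (measurableTypeR R) -> \bar R})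
    (f : R -> R) (B r : R) : 0 < r -> 0 <= B -> measurable_fun setT f ->
  (forall x, (1 + x ^+ 2) * `|f x| <= B) ->
  (\int[mu]_x `|f (r^-1 * x)|%:E <= \sum_(0 <= k <oo)
    (decay_weight B k)%:E * (mu (annulus_right r k) + mu (annulus_left r k)))%E.
Proof.
move=> r0 B0 mf fB.
pose F k : set (measurableTypeR R) :=
  (fun x : R => `|x|) @^-1` `[k%:R * r, k.+1%:R * r[%classic.
have mF k : measurable (F k).
  have := @normr_measurable R setT measurableT _ (measurable_itv `[k%:R * r, k.+1%:R * r[).
  by rewrite setTI.
have mfr : measurable_fun [set: measurableTypeR R] (fun x : R => `|f (r^-1 * x)|%:E).
  apply/measurable_EFinP; apply: measurableT_comp => //.
  by apply: (measurableT_comp mf); exact: measurable_funM.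
have FT : \bigcup_k F k = setT.
  apply/seteqP; split => // x _; exists (Num.truncn (`|x| / r)) => //.
  have /andP[h1 h2] : ((Num.truncn (`|x| / r))%:R <= `|x| / r <
      (Num.truncn (`|x| / r)).+1%:R).
    by apply: truncn_itv; rewrite divr_ge0// ltW.
  by rewrite /F /= in_itv/= -ler_pdivlMr// h1 -ltr_pdivrMr.
have trivF : trivIset setT F.
  apply/trivIsetP => i j _ _; wlog ij : i j / (i < j)%N => [hw|].
    by rewrite neq_ltn => /orP[ij|ij]; [|rewrite setIC];
      apply: hw => //; rewrite neq_ltn ij.
  move=> _; apply/seteqP; split => // x []; rewrite /F /= !in_itv/=.
  move=> /andP[_ xi] /andP[xj _].
  have := le_lt_trans xj xi; rewrite ltr_pM2r// ltr_nat ltnS leqNgt ij.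
  by [].
rewrite -FT ge0_integral_bigcup//; last by rewrite FT.
apply: lee_nneseries => k _; first by move=> _; exact: integral_ge0.
apply: (@le_trans _ _ (\int[mu]_(x in F k) (cst (decay_weight B k)%:E x))%E).
  apply: ge0_le_integral => //.
  - exact: measurable_funS mfr.
  - move=> x; rewrite /F /= in_itv/= => /andP[kx _]; rewrite lee_fin.
    apply: (@decay_weightP _ _ (r^-1 * x)) => //.
    by rewrite normrM gtr0_norm ?invr_gt0// mulrC ler_pdivlMr.
rewrite integral_cst// lee_wpmul2l ?lee_fin ?decay_weight_ge0//.
apply: (@le_trans _ _ (mu (annulus_right r k `|` annulus_left r k))).
  apply: le_measure; rewrite ?inE//.
    by apply: measurableU; exact: measurable_itv.
  move=> x; rewrite /F /annulus_right /annulus_left /= !in_itv/=.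
  by case: (leP 0 x) => x0; [rewrite ger0_norm|rewrite ltr0_norm]; lra.
by apply: measureU2; exact: measurable_itv.
Qed.

End quadratic_decay.

(** * Mean counts of a stationary process *)

Section stationary_mean.
Context {R : realType} {d : measure_display} {Omega : measurableType d}.
Variables (Pr : probability Omega R) (P : R.-ker Omega ~> measurableTypeR R).
Hypotheses (Pst : stationary Pr P) (Psq : locally_square_integrable Pr P).

Lemma mean_count_lty (B : set R) : measurable B -> bounded_set B ->
  (\int[Pr]_w P w B < +oo)%E.
Proof.
move=> mB bB; have mPB : measurable_fun setT (P ^~ B) by exact: measurable_kernel.
have mPB2 : measurable_fun setT (fun w => P w B ^+ 2)%E.
  by under eq_fun do rewrite expe2; exact: emeasurable_funM.
apply: (@le_lt_trans _ _ (\int[Pr]_w (1 + P w B ^+ 2))%E).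
  apply: ge0_le_integral => //.
  - exact: emeasurable_funD.
  - move=> w _; have := measure_ge0 (P w) B; case: (P w B) => [x| |]//=.
    by move=> _; rewrite -EFinM -EFinD lee_fin; have := sqr_ge0 (x - 1 / 2); nra.
rewrite ge0_integralD//.
- rewrite (integral_cst Pr measurableT 1%E) mul1e.
  rewrite [X in (X + _)%E](@probability_setT _ _ _ Pr).
  by rewrite lte_add_pinfty ?ltry//; exact: Psq.
- by move=> w _; rewrite expe_ge0.
Qed.

Lemma stationary_mean_count (a : R) (B : set R) : measurable B ->
  (\int[Pr]_w P w ((fun x => (x + a)%R) @^-1` B) = \int[Pr]_w P w B)%E.
Proof.
move=> mB; set Ba := _ @^-1` B.
have mBa : measurable Ba.
  rewrite /Ba -[X in measurable X]setTI.
  by apply: (@measurable_funD _ _ R setT id (cst a)).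
have mX (D : set R) : measurable D -> measurable_fun setT (P ^~ D).
  by move=> mD; exact: measurable_kernel.
have E D : measurable D ->
    (\int[Pr]_w P w D = \int[pushforward Pr (P ^~ D)]_y `|y|)%E.
  move=> mD; rewrite ge0_integral_pushforward//; last exact: mX.
  by apply: eq_integral => w _ /=; rewrite gee0_abs.
rewrite !E//; apply: eq_measure_integral => [||pa pb U mU _]; [exact: mX|exact: mX|].
have := @Pst a [set mu | U (mu B)]; apply.
by apply: sub_sigma_algebra; exists B, U.
Qed.

Lemma mean_count_itv (a r : R) :
  (\int[Pr]_w P w `[a, (a + r)%R]%classic = \int[Pr]_w P w `[0%R, r]%classic)%E.
Proof.
rewrite -[LHS](stationary_mean_count a); last exact: measurable_itv.
congr (integral _ _ _); apply/funext => w; congr (P w _).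
by apply/seteqP; split => x /=; rewrite !in_itv/= lerDr addrC lerD2l.
Qed.

(** All the intervals of the annuli have the same finite mean count, which
    factors out of the series. *)
Lemma mean_decay_lty (f : R -> R) (B r : R) : 0 < r -> 0 <= B ->
  measurable_fun setT f -> (forall x, (1 + x ^+ 2) * `|f x| <= B) ->
  (\int[Pr]_w \int[P w]_x `|f (r^-1 * x)|%:E < +oo)%E.
Proof.
move=> r0 B0 mf fB.
have mJ k : measurable (annulus_right r k) by exact: measurable_itv.
have mJ' k : measurable (annulus_left r k) by exact: measurable_itv.
have mX (D : set R) : measurable D -> measurable_fun setT (P ^~ D).
  by move=> mD; exact: measurable_kernel.
apply: (@le_lt_trans _ _ (\int[Pr]_w \sum_(0 <= k <oo)
    (decay_weight B k)%:E * (P w (annulus_right r k) + P w (annulus_left r k)))%E).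
  apply: ge0_le_integral => //.
  - by move=> w _; exact: integral_ge0.
  - apply: measurable_integral_kernel; apply/measurable_EFinP.
    apply: measurableT_comp => //.
    by apply: (measurableT_comp mf); exact: measurable_funM.
  - apply: ge0_emeasurable_sum => k *.
      by rewrite mule_ge0 ?lee_fin ?decay_weight_ge0// adde_ge0.
    by apply: measurable_funeM; apply: emeasurable_funD; exact: mX.
  - by move=> w _; exact: integral_le_annuli.
rewrite integral_nneseries//.
- pose m := (\int[Pr]_w P w `[0%R, r]%classic)%E.
  have m0 : (0 <= m)%E by exact: integral_ge0.
  have mlty : (m < +oo)%E.
    by apply: mean_count_lty; [exact: measurable_itv|exact: bounded_set_itvcc].
  have mE : m = (fine m)%:E by rewrite fineK// ge0_fin_numE.
  have Em k : (\int[Pr]_w ((decay_weight B k)%:E *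
      (P w (annulus_right r k) + P w (annulus_left r k))) =
      (fine m + fine m)%:E * (decay_weight B k)%:E)%E.
    rewrite EFinD -mE ge0_integralZl_EFin ?decay_weight_ge0//; last 2 first.
    - by move=> w _; rewrite adde_ge0.
    - by apply: emeasurable_funD; exact: mX.
    rewrite ge0_integralD//; [|exact: mX..].
    rewrite muleC; congr (_ * _)%E; congr (_ + _)%E.
      rewrite /m -(mean_count_itv (k%:R * r)); apply: eq_integral => w _.
      by rewrite /annulus_right -natr1 mulrDl mul1r.
    rewrite /m -(mean_count_itv (- (k.+1%:R * r))); apply: eq_integral => w _.
    rewrite /annulus_left (_ : - (k.+1%:R * r) + r = - (k%:R * r))//.
    by rewrite -natr1; ring.
  under eq_eseriesr do rewrite Em.
  rewrite nneseriesZl; last by move=> k _; rewrite lee_fin decay_weight_ge0.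
  rewrite lte_mul_pinfty ?lee_fin ?addr_ge0 ?fine_ge0//.
  by rewrite (le_lt_trans (decay_weight_series B0))// ltry.
- by move=> k; apply: measurable_funeM; apply: emeasurable_funD; exact: mX.
- by move=> k w _; rewrite mule_ge0 ?lee_fin ?decay_weight_ge0// adde_ge0.
Qed.

End stationary_mean.

(** * The variance as a quadratic form on test functions *)

Section variance_functional.
Context {R : realType} {d : measure_display} {Omega : measurableType d}.
Variables (Pr : probability Omega R) (P : R.-ker Omega ~> measurableTypeR R).
Variable C : signed_radon_measure R.
Local Notation tv := (srm_total_variation C).
Local Notation leb := (@lebesgue_measure R).
Hypothesis Pcorr : correlation_measure Pr P C.
Hypothesis moment3 : (\int[tv]_t (`|t| ^+ 3)%:E < +oo)%E.
Implicit Types (f g : R -> R).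

Definition energy f : R := sint C (autocorr f).

Lemma variance_energy f : test_function f ->
  'V_Pr[linstat P f]%E = (energy f)%:E.
Proof.
by move=> tf; rewrite /variance Pcorr// (autocorr_correlation moment3 tf).2.
Qed.

Lemma energy_ge0 f : test_function f -> 0 <= energy f.
Proof. by move=> tf; rewrite -lee_fin -variance_energy// variance_ge0. Qed.

(** By the parallelogram law, because the energy of f - g, a variance, is
    nonnegative; this replaces an estimate of the mixed terms. *)
Lemma energyD_le f g : test_function f -> test_function g ->
  energy (fun x => f x + g x) <= 2 * (energy f + energy g).
Proof.
move=> tf tg.
have tD := test_functionD tf tg; have tB := test_functionB tf tg.
have iD := (autocorr_correlation moment3 tD).1.
have iB := (autocorr_correlation moment3 tB).1.
have if_ := (autocorr_correlation moment3 tf).1.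
have ig := (autocorr_correlation moment3 tg).1.
suff parallelogram : energy (fun x => f x + g x) + energy (fun x => f x - g x) =
    2 * (energy f + energy g).
  by rewrite -parallelogram lerDl energy_ge0.
rewrite /energy -!sintD// -sintZ; last exact: (integrableD measurableT if_ ig).
congr (sint C _); apply/funext => x; rewrite /autocorr.
have iF h : test_function h ->
    leb.-integrable setT (EFin \o (fun y => h y * h (x + y))).
  exact: autocorr_integrand_integrable.
rewrite -!RintegralD//; [|exact: iF..].
rewrite -RintegralZl//; last exact: (integrableD measurableT (iF _ tf) (iF _ tg)).
by apply: eq_Rintegral => y _; ring.
Qed.

Lemma energy_le f b : test_function f -> (forall x, `|f x| <= b) ->
  energy f <= b * (\int[leb]_y `|f y|) * fine (tv setT).
Proof.
move=> tf fb; have fi := (autocorr_correlation moment3 tf).1.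
rewrite (le_trans (ler_norm _))// (le_trans (le_normr_sint fi))//.
rewrite -Rintegral_cst//; apply: le_Rintegral => //.
- exact: integrable_norm.
- by apply: (@tv_integrable_bounded _ _ moment3 _ (`|b * (\int[leb]_y `|f y|)|)).
- by move=> x _; exact: le_autocorr.
Qed.

Lemma autocorr_modulus f (L : R) x : test_function f ->
  (forall x y, `|f x - f y| <= L * `|x - y|) ->
  `|autocorr f x - \int[leb]_y (f y ^+ 2)| <= L * (\int[leb]_y `|f y|) * `|x|.
Proof.
move=> tf fL.
have ti := test_function_integrable_lebesgue (test_functionM tf tf).
have ni := integrable_norm (test_function_integrable_lebesgue tf).
have ai := autocorr_integrand_integrable x tf.
rewrite [X in _ - X](_ : _ = \int[leb]_y (f y * f y)); last first.
  by apply: eq_Rintegral => y _; rewrite expr2.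
rewrite /autocorr -RintegralB//.
have di := integrableB measurableT ai ti.
rewrite (le_trans (le_normr_Rintegral _ di))//.
rewrite mulrAC -RintegralZl//; apply: le_Rintegral => //.
- exact: (integrable_norm di).
- exact: (integrableZl _ (L * `|x|) ni).
- move=> y _ /=; rewrite -mulrBr normrM mulrC ler_wpM2r//.
  by rewrite (le_trans (fL _ _))// addrK.
Qed.

(** If f varies slowly, its autocorrelation is almost constant at the scale where
    [C] has its mass, so the energy is almost the total mass times the squared
    L2 norm of f. *)
Lemma total_mass_energy f (L : R) : test_function f ->
  (forall x y, `|f x - f y| <= L * `|x - y|) ->
  `|sint C (cst 1)| * \int[leb]_y (f y ^+ 2) <=
    energy f + L * (\int[leb]_y `|f y|) * \int[tv]_x `|x|.
Proof.
move=> tf fL; set E0 := \int[leb]_y (f y ^+ 2).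
have E00 : 0 <= E0 by apply: Rintegral_ge0 => y _; exact: sqr_ge0.
have ai := (autocorr_correlation moment3 tf).1.
have ci (c : R) : tv.-integrable setT (EFin \o cst c).
  by apply: (@tv_integrable_bounded _ _ moment3 _ `|c|).
have xi : tv.-integrable setT (EFin \o (fun x : R => `|x|)).
  apply: (@tv_integrable_cubic _ _ moment3 _ 1); first exact: normr_measurable.
  move=> t; rewrite normr_id mul1r; have := normr_ge0 t.
  move: (`|t|) => s s0; have [s1|/ltW s1] := leP s 1.
    by have := exprn_ge0 3 s0; lra.
  by rewrite (le_trans (ler_eXnr _ s1 : s <= s ^+ 3))// lerDr.
have E1 : sint C (fun x => autocorr f x - E0) = energy f - E0 * sint C (cst 1).
  rewrite (sintB ai (ci E0)) -sintZ//; congr (_ - sint C _).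
  by apply/funext => x /=; rewrite mulr1.
have di : tv.-integrable setT (EFin \o (fun x => autocorr f x - E0)).
  exact: (integrableB measurableT ai (ci E0)).
have := le_normr_sint di; rewrite E1.
have le2 : \int[tv]_x `|autocorr f x - E0| <=
    L * (\int[leb]_y `|f y|) * \int[tv]_x `|x|.
  rewrite -RintegralZl//; apply: le_Rintegral => //.
  - exact: (integrable_norm di).
  - exact: (integrableZl _ _ xi).
  - by move=> x _; exact: autocorr_modulus.
move=> /le_trans => /(_ _ le2) le3.
rewrite -{1}(ger0_norm E00) -normrM mulrC -lerBlDl.
rewrite (le_trans _ le3)// [leRHS]distrC.
have := lerB_dist (E0 * sint C (cst 1)) (energy f).
by rewrite (ger0_norm (energy_ge0 tf)).
Qed.

End variance_functional.

(** * Truncations of rescaled Schwartz functions *)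

Section schwartz_functions.
Context {R : realType}.
Implicit Types (f : R -> R).

Lemma schwartz_derivable f x : schwartz f -> derivable f x 1.
Proof. by case=> df _; exact: (df 0%N). Qed.

Lemma schwartz_continuous f : schwartz f -> continuous f.
Proof.
by move=> sf x; apply/differentiable_continuous/derivable1_diffP/schwartz_derivable.
Qed.

Lemma schwartz_measurable f : schwartz f -> measurable_fun setT f.
Proof. by move=> /schwartz_continuous; exact: continuous_measurable_fun. Qed.

Lemma schwartz_decay f : schwartz f ->
  exists2 B, 0 <= B & forall x, (1 + x ^+ 2) * `|f x| <= B.
Proof.
move=> [_ sf]; have [M0 fM0] := sf 0%N 0%N; have [M2 fM2] := sf 2%N 0%N.
have fM x : (1 + x ^+ 2) * `|f x| <= M0 + M2.
  rewrite mulrDl lerD//; first by rewrite mul1r; have := fM0 x; rewrite expr0 mul1r.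
  by have := fM2 x; rewrite /= normrM ger0_norm ?sqr_ge0.
by exists (M0 + M2) => //; rewrite (le_trans _ (fM 0))// mulr_ge0 ?addr_ge0 ?sqr_ge0.
Qed.

Lemma schwartz_lipschitz f : schwartz f ->
  exists2 L, 0 <= L & forall x y, `|f x - f y| <= L * `|x - y|.
Proof.
move=> sf; have [_ /(_ 0%N 1%N)[L fL]] := sf.
have fL' x : `|(f^`())%classic x| <= L by have := fL x; rewrite expr0 mul1r.
exists L; first exact: le_trans (fL' 0).
move=> x y; wlog xy : x y / x < y => [hw|].
  have [/hw//|yx|->] := ltgtP x y; last by rewrite !subrr normr0 mulr0.
  by rewrite distrC [X in _ * X]distrC; exact: hw.
have fd z : z \in `]x, y[%R -> is_derive z 1 f ((f^`())%classic z).
  by move=> _; rewrite derive1E; exact/derivableP/schwartz_derivable.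
have fc : {within `[x, y], continuous f}.
  by apply: continuous_subspaceT; exact: schwartz_continuous.
have [z _ fE] := MVT xy fd fc.
by rewrite distrC fE normrM [X in _ * X]distrC ler_wpM2r.
Qed.

(** Piecewise linear, hence Lipschitz: cutting off abruptly would destroy the
    modulus of continuity that controls the autocorrelation near 0. *)
Definition cutoff (n : nat) (x : R) : R :=
  Num.max 0 (Num.min 1 (n%:R + 1 - `|x|)).

Lemma cutoff_ge0 n x : 0 <= cutoff n x.
Proof. by rewrite /cutoff le_max lexx. Qed.

Lemma cutoff_le1 n x : cutoff n x <= 1.
Proof. by rewrite /cutoff ge_max ler01 ge_min lexx. Qed.

Lemma cutoff1 n x : `|x| <= n%:R -> cutoff n x = 1.
Proof.
by move=> xn; rewrite /cutoff min_l ?max_r//; lra.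
Qed.

Lemma cutoff0 n x : n%:R + 1 < `|x| -> cutoff n x = 0.
Proof. by move=> xn; rewrite /cutoff max_l// ge_min; apply/orP; right; lra. Qed.

Lemma cutoff_lipschitz n x y : `|cutoff n x - cutoff n y| <= `|x - y|.
Proof.
have : `| `|x| - `|y| | <= `|x - y| by exact: ler_dist_dist.
rewrite ler_norml => /andP[h1 h2]; rewrite ler_norml /cutoff.
by rewrite /Num.max /Num.min; do !case: ifPn; rewrite -?leNgt; lra.
Qed.

Lemma measurable_cutoff n : measurable_fun setT (cutoff n).
Proof.
apply: measurable_maxr => //; apply: measurable_minr => //.
by apply: measurable_funB => //; exact: normr_measurable.
Qed.

End schwartz_functions.


Section rescaled_truncation.
Context {R : realType}.
Local Notation leb := (@lebesgue_measure R).
Variables (f : R -> R) (B L r : R).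
Hypotheses (mf : measurable_fun setT f) (B0 : 0 <= B) (L0 : 0 <= L) (r0 : 0 < r).
Hypothesis fB : forall x, (1 + x ^+ 2) * `|f x| <= B.
Hypothesis fL : forall x y, `|f x - f y| <= L * `|x - y|.

Definition truncation (n : nat) (x : R) : R := f (r^-1 * x) * cutoff n (r^-1 * x).

Let rV0 : 0 < r^-1. Proof. by rewrite invr_gt0. Qed.

Let fB1 x : `|f x| <= B.
Proof. by apply: le_trans (fB x); rewrite ler_peMl// lerDl sqr_ge0. Qed.

Let measurable_scale (g : R -> R) : measurable_fun setT g ->
  measurable_fun setT (fun x : R => g (r^-1 * x)).
Proof. by move=> mg; apply: (measurableT_comp mg); exact: measurable_funM. Qed.

Lemma le_truncation n x : `|truncation n x| <= `|f (r^-1 * x)|.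
Proof.
rewrite /truncation normrM ler_piMr// ger0_norm ?cutoff_ge0//.
exact: cutoff_le1.
Qed.

Lemma test_function_truncation n : test_function (truncation n).
Proof.
apply/test_functionP; split.
  apply: measurable_funM; first exact: measurable_scale.
  by apply: measurable_scale; exact: measurable_cutoff.
exists B, (r * (n%:R + 1)) => x; split.
  exact: le_trans (le_truncation n x) (fB1 _).
move=> rx; rewrite /truncation cutoff0 ?mulr0//.
by rewrite normrM gtr0_norm// ltr_pdivlMl.
Qed.

(** The Lipschitz constant is of order 1 / r uniformly in n, which compensates
    the L1 norm of order r in [total_mass_energy]. *)
Lemma truncation_lipschitz n x y :
  `|truncation n x - truncation n y| <= (L + B) / r * `|x - y|.
Proof.
rewrite /truncation; set u := r^-1 * x; set v := r^-1 * y.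
have -> : f u * cutoff n u - f v * cutoff n v =
    (f u - f v) * cutoff n u + f v * (cutoff n u - cutoff n v) by ring.
have uv : `|u - v| = r^-1 * `|x - y|.
  by rewrite /u /v -mulrBr normrM gtr0_norm.
rewrite (le_trans (ler_normD _ _))// !normrM -mulrA -uv mulrDl lerD//.
  rewrite (le_trans _ (fL u v))// ler_piMr// ger0_norm ?cutoff_ge0//.
  exact: cutoff_le1.
by rewrite ler_pM// cutoff_lipschitz.
Qed.

Lemma Rintegral_scale_le (g : R -> R) : test_function g ->
  (forall x, `|g x| <= `|f (r^-1 * x)|) -> \int[leb]_x `|g x| <= 8 * B * r.
Proof.
move=> tg gf; have gi := integrable_norm (test_function_integrable_lebesgue tg).
rewrite -lee_fin /Rintegral fineK; last exact: (integrable_fin_num measurableT gi).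
apply: (@le_trans _ _ (\int[leb]_x `|f (r^-1 * x)|%:E)%E).
  apply: ge0_le_integral => //.
  - exact: measurable_int gi.
  - apply/measurable_EFinP; apply: measurableT_comp => //.
    exact: measurable_scale.
  - by move=> x _; rewrite lee_fin.
apply: le_trans (integral_le_annuli leb r0 B0 mf fB) _.
have annuliE k : ((decay_weight B k)%:E *
    (leb (annulus_right r k) + leb (annulus_left r k)) =
    (2 * r)%:E * (decay_weight B k)%:E)%E.
  have kr : k%:R * r < k.+1%:R * r by rewrite ltr_pM2r// ltr_nat.
  rewrite muleC; congr (_ * _)%E.
  rewrite /annulus_left /annulus_right !lebesgue_measure_itv/= !lte_fin.
  rewrite ltrN2 kr -!EFinB -EFinD; congr EFin.
  by rewrite -natr1; ring.
under eq_eseriesr do rewrite annuliE.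
rewrite nneseriesZl; last by move=> k _; rewrite lee_fin decay_weight_ge0.
rewrite (_ : 8 * B * r = (2 * r) * (4 * B)); last by ring.
rewrite [leRHS]EFinM lee_wpmul2l ?lee_fin ?mulr_ge0 ?(ltW r0)//.
exact: decay_weight_series.
Qed.

Lemma truncationB_le n m x : (n <= m)%N ->
  `|truncation n x - truncation m x| <= B / (1 + n%:R ^+ 2) /\
  `|truncation n x - truncation m x| <= `|f (r^-1 * x)|.
Proof.
move=> nm; rewrite /truncation -mulrBr normrM; set u := r^-1 * x.
have c1 : `|cutoff n u - cutoff m u| <= 1.
  rewrite ler_norml; have := cutoff_ge0 n u; have := cutoff_ge0 m u.
  by have := cutoff_le1 n u; have := cutoff_le1 m u; lra.
split; last by rewrite ler_piMr.
have n20 : 0 < 1 + n%:R ^+ 2 :> R by rewrite ltr_pwDl// sqr_ge0.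
have [un|un] := leP `|u| n%:R.
  rewrite !cutoff1// ?(le_trans un) ?ler_nat// subrr normr0 mulr0.
  by rewrite divr_ge0// ltW.
rewrite ler_pdivlMr//.
apply: (@le_trans _ _ (`|f u| * (1 + u ^+ 2))); last by rewrite mulrC fB.
rewrite -mulrA ler_wpM2l//; apply: (@le_trans _ _ (1 + n%:R ^+ 2)).
  by rewrite ler_piMl// ltW.
by rewrite lerD2l -[u ^+ 2]real_normK ?num_real// lerXn2r// ?nnegrE// ltW.
Qed.

Lemma truncation_cvg x : truncation m x @[m --> \oo] --> f (r^-1 * x).
Proof.
apply: cvg_near_cst; exists (Num.truncn `|r^-1 * x|).+1 => // m /= xm.
rewrite /truncation cutoff1 ?mulr1//; apply: ltW.
have /andP[_ h] := truncn_itv (normr_ge0 (r^-1 * x)).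
by rewrite (lt_le_trans h)// ler_nat.
Qed.

(** A Lipschitz function stays above half of |f x0| at distance at most e of x0,
    an interval that scaling by r stretches to length 2 e r. *)
Lemma truncation_square_ge (x0 e : R) n : 0 < e -> L * e <= `|f x0| / 2 ->
  `|x0| + e <= n%:R ->
  (`|f x0| / 2) ^+ 2 * (2 * e * r) <= \int[leb]_x (truncation n x ^+ 2).
Proof.
move=> e0 Le xen; set c := `|f x0| / 2.
pose I : set (measurableTypeR R) := `[r * (x0 - e), r * (x0 + e)]%classic.
have mI : measurable I by exact: measurable_itv.
have ti := test_function_integrable_lebesgue
  (test_functionM (test_function_truncation n) (test_function_truncation n)).
have Ilt : r * (x0 - e) < r * (x0 + e) by rewrite ltr_pM2l//; lra.
have II : leb I = (2 * e * r)%:E.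
  by rewrite /I lebesgue_measure_itv/= lte_fin Ilt -EFinB; congr EFin; ring.
have Ii : leb.-integrable setT (EFin \o \1_I).
  exact: integrable_indic_itv.
have -> : 2 * e * r = \int[leb]_x \1_I x.
  by rewrite /Rintegral integral_indic// setIT [X in fine X]II.
rewrite -RintegralZl//; apply: le_Rintegral => //.
  exact: (integrableZl _ _ Ii).
move=> x _; rewrite indicE; case: (boolP (x \in I)) => [|_]; last first.
  by rewrite mulr0 sqr_ge0.
rewrite inE /I /= in_itv/= => /andP[x1 x2]; rewrite mulr1.
have ux0 : `|x0 - r^-1 * x| <= e.
  rewrite ler_norml -(ler_pM2l r0) -[X in _ && X](ler_pM2l r0).
  by rewrite mulrBr mulrA divff ?gt_eqF// mul1r; lra.
have c0 : 0 <= c by rewrite divr_ge0.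
rewrite /truncation cutoff1 ?mulr1; last first.
  have := ler_dist_dist x0 (r^-1 * x); rewrite ler_norml => /andP[+ _].
  by lra.
rewrite -[leRHS]real_normK ?num_real// lerXn2r ?nnegrE//.
have := le_trans (fL x0 (r^-1 * x)) (ler_wpM2l L0 ux0).
have := ler_norm (`|f x0| - `|f (r^-1 * x)|).
have := ler_dist_dist (f x0) (f (r^-1 * x)); rewrite /c in c0 *; lra.
Qed.

End rescaled_truncation.

(** * Hyperuniformity and the total mass of the correlation measure *)

Section vanishing_mass.
Context {R : realType} {d : measure_display} {Omega : measurableType d}.
Variables (Pr : probability Omega R) (P : R.-ker Omega ~> measurableTypeR R).
Variable C : signed_radon_measure R.
Local Notation tv := (srm_total_variation C).
Local Notation leb := (@lebesgue_measure R).
Hypotheses (Ppp : point_process P) (Pst : stationary Pr P).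
Hypotheses (Psq : locally_square_integrable Pr P).
Hypothesis Pcorr : correlation_measure Pr P C.
Hypothesis moment3 : (\int[tv]_t (`|t| ^+ 3)%:E < +oo)%E.

Let T : R := fine (tv setT).

Let M1 : R := \int[tv]_x `|x|.

(** The part discarded by the truncation has sup norm at most B / (1 + n ^ 2) and
    L1 norm at most 8 B r: its variance is small compared with r as soon as n is
    large, uniformly in r. *)
Lemma truncation_energy_le (f : R -> R) (B r : R) (n : nat) : 0 < r -> 0 <= B ->
  measurable_fun setT f -> (forall x, (1 + x ^+ 2) * `|f x| <= B) ->
  ((energy C (truncation f r n))%:E <=
   2%:E * ('V_Pr[linstat P (fun x => f (r^-1 * x))%R] +
           (B / (1 + n%:R ^+ 2) * (8 * B * r) * T)%:E))%E.
Proof.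
move=> r0 B0 mf fB.
have tk := test_function_truncation mf r0 fB.
have mfr : measurable_fun setT (fun x => f (r^-1 * x)).
  by apply: (measurableT_comp mf); exact: measurable_funM.
rewrite -(variance_energy Pcorr moment3)//.
apply: (variance_truncation_le Ppp tk mfr (le_truncation f r)).
- exact: truncation_cvg.
- exact: (mean_decay_lty Pst Psq r0 B0 mf fB).
move=> m nm; have tB := test_functionB (tk n) (tk m).
have Bx x := truncationB_le r B0 fB x nm.
rewrite (variance_energy Pcorr moment3)// lee_fin.
apply: le_trans (energy_le moment3 tB (fun x => (Bx x).1)) _.
rewrite ler_wpM2r ?fine_ge0// ler_wpM2l//.
  by rewrite divr_ge0// addr_ge0// sqr_ge0.
by apply: (Rintegral_scale_le mf B0 r0 fB tB) => x; exact: (Bx x).2.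
Qed.

(** First n is chosen so that the truncation error is small compared with what a
    nonzero mass would contribute, then r is sent to infinity. *)
Lemma total_mass_eq0 : hyperuniform Pr P -> sint C (cst 1) = 0.
Proof.
move=> [f [sf intf hyper]].
have mf := schwartz_measurable sf.
have [B B0 fB] := schwartz_decay sf; have [L L0 fL] := schwartz_lipschitz sf.
have [x0 fx0] : exists x0, f x0 != 0.
  apply: contrapT => /forallNP f0; move/eqP: intf; apply.
  rewrite (_ : f = cst 0); first by rewrite Rintegral_cst// mul0r.
  by apply/funext => x; apply/eqP/negPn/negP; exact: f0.
pose c := `|f x0| / 2; have c0 : 0 < c by rewrite divr_gt0// normr_gt0.
pose e := c / (L + 1); have e0 : 0 < e by rewrite divr_gt0// ltr_wpDl.
have Le : L * e <= c.
  by rewrite /e mulrCA ler_piMr ?(ltW c0)// ler_pdivrMr ?ltr_wpDl// mul1r lerDl.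
pose m := `|sint C (cst 1)|; pose k := c ^+ 2 * (2 * e).
have k0 : 0 < k by rewrite mulr_gt0 ?exprn_gt0// mulr_gt0.
have T0 : 0 <= T by rewrite fine_ge0.
have M10 : 0 <= M1 by apply: Rintegral_ge0.
pose K := (L + B) * (8 * B) * M1.
(* The three terms are the variance, the truncation error and the error due to
   the variation of f over unit distances. *)
have key r n : 0 < r -> `|x0| + e <= n%:R ->
    ((m * k * r)%:E <=
     2%:E * 'V_Pr[linstat P (fun x => f (r^-1 * x))%R] +
     (16 * B ^+ 2 * T / (1 + n%:R ^+ 2) * r + K)%:E)%E.
  move=> r0 xn; have tk := test_function_truncation mf r0 fB n.
  have LB0 : 0 <= (L + B) / r by rewrite divr_ge0 ?addr_ge0// ltW.
  have h1 := total_mass_energy Pcorr moment3 tk (truncation_lipschitz r0 fB fL n).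
  have h2 := truncation_square_ge mf L0 r0 fB fL e0 Le xn.
  have h3 := Rintegral_scale_le mf B0 r0 fB tk (le_truncation f r n).
  have h4 := truncation_energy_le n r0 B0 mf fB.
  have h5 : m * k * r <= energy C (truncation f r n) + K.
    apply: (@le_trans _ _ (m * \int[leb]_x (truncation f r n x ^+ 2))).
      rewrite -mulrA; apply: ler_wpM2l; first exact: normr_ge0.
      by apply: le_trans h2; rewrite /k -mulrA.
    rewrite (le_trans h1)// lerD2l.
    apply: (@le_trans _ _ ((L + B) / r * (8 * B * r) * M1)).
      by rewrite ler_wpM2r// ler_wpM2l.
    rewrite le_eqVlt; apply/orP; left; apply/eqP; rewrite /K; field.
    exact: lt0r_neq0.
  apply: (@le_trans _ _ (energy C (truncation f r n) + K)%:E).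
    by rewrite lee_fin.
  rewrite EFinD [X in (_ <= _ + X)%E]EFinD addeA leeD2r//.
  apply: le_trans h4 _; rewrite muleDr ?fin_num_adde_defl//.
  rewrite leeD2l// -EFinM lee_fin le_eqVlt; apply/orP; left; apply/eqP.
  by field; rewrite gt_eqF// ltr_pwDl// sqr_ge0.
apply/eqP; rewrite -normr_eq0 -/m; apply/negPn/negP => m_neq0.
have m0 : 0 < m by rewrite lt_def m_neq0 normr_ge0.
have mk0 : 0 < m * k by rewrite mulr_gt0.
have [X X0 XE] : exists2 X, 0 <= X & X * (m * k) = 64 * B ^+ 2 * T.
  exists (64 * B ^+ 2 * T / (m * k)); last by rewrite mulfVK ?gt_eqF.
  by rewrite divr_ge0 ?(ltW mk0)// !mulr_ge0 ?exprn_ge0.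
pose n := (Num.truncn (`|x0| + e + X)).+1.
have nX : `|x0| + e + X <= n%:R.
  apply/ltW; have /andP[_] := truncn_itv (addr_ge0 (addr_ge0 (normr_ge0 x0) (ltW e0)) X0).
  exact.
have n1 : 1 <= n%:R :> R by rewrite ler1n.
have truncation_small : 16 * B ^+ 2 * T / (1 + n%:R ^+ 2) <= m * k / 4.
  rewrite ler_pdivrMr ?ltr_pwDl ?sqr_ge0//.
  have -> : 16 * B ^+ 2 * T = m * k / 4 * X by move: XE; clearbody k m; lra.
  rewrite ler_wpM2l ?divr_ge0 ?(ltW mk0)//.
  have nn : n%:R <= n%:R ^+ 2 :> R by rewrite ler_eXnr.
  by have := normr_ge0 x0; lra.
have /fine_cvgP[fin_near /cvgr0Pnorm_lt/(_ (m * k / 8)) small] := hyper.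
have mk80 : 0 < m * k / 8 by rewrite divr_gt0.
have {}small := small mk80.
have [r [r0 rK rfin rsmall]] : exists r : R, [/\ 0 < r, 4 * K / (m * k) < r,
    ('V_Pr[(linstat P (fun x => f (r^-1 * x)))%R] * (r^-1)%:E)%E \is a fin_num &
    `|fine ('V_Pr[(linstat P (fun x => f (r^-1 * x)))%R] * (r^-1)%:E)%E| < m * k / 8].
  near (pinfty_nbhs R) => r; exists r; split.
  - by near: r; exact: nbhs_pinfty_gt.
  - by near: r; apply: nbhs_pinfty_gt; exact: num_real.
  - by near: r.
  - by near: r.
have xn : `|x0| + e <= n%:R by lra.
move: (key r n r0 xn) rfin rsmall.
have := variance_ge0 Pr (linstat P (fun x => f (r^-1 * x))).
case: ('V_Pr[_])%E => [V| |]//; last first.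
  by move=> _ _; rewrite gt0_mulye// lte_fin invr_gt0.
rewrite lee_fin => V0; rewrite -EFinM -EFinD lee_fin => h _.
rewrite -EFinM /= ger0_norm ?divr_ge0 ?(ltW r0)// ltr_pdivrMr// => Vr.
rewrite ltr_pdivrMr// in rK.
have h2 : 16 * B ^+ 2 * T / (1 + n%:R ^+ 2) * r <= m * k / 4 * r.
  by rewrite ler_wpM2r// ltW.
have : 0 < m * k * r by rewrite mulr_gt0.
lra.
Unshelve. all: by end_near.
Qed.

End vanishing_mass.

(** * The trial profile and its second order expansion *)

Section trial_profile.
Context {R : realType}.
Implicit Types (v w : R).

Definition bump v : R := Num.max 0 (1 - v ^+ 2).

Definition profile (j : nat) v : R := v ^+ j * bump v ^+ 2.

(** Coefficients of w ^ 0 and w ^ 2 in profile (v - w) * profile (v + w), for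
    j = 0 and j = 1; that product is even in w, so the next term is of order 4. *)
Definition profile_coef0 (j : nat) v : R := (v ^+ 2) ^+ j * bump v ^+ 4.

Definition profile_coef2 (j : nat) v : R :=
  - (4 * (v ^+ 2) ^+ j * (1 + v ^+ 2) * bump v ^+ 2 + j%:R * bump v ^+ 4).

Definition profile_error (j : nat) v w : R :=
  profile j (v - w) * profile j (v + w) - profile_coef0 j v
  - profile_coef2 j v * w ^+ 2.

Lemma bump_ge0 v : 0 <= bump v.
Proof. by rewrite /bump le_max lexx. Qed.

Lemma bump_le1 v : bump v <= 1.
Proof. by rewrite /bump ge_max ler01 lerBlDr lerDl sqr_ge0. Qed.

Lemma bumpE v : v ^+ 2 <= 1 -> bump v = 1 - v ^+ 2.
Proof. by move=> v1; rewrite /bump max_r// subr_ge0. Qed.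

Lemma bump0 v : 1 <= v ^+ 2 -> bump v = 0.
Proof. by move=> v1; rewrite /bump max_l// subr_le0. Qed.

Lemma measurable_bump : measurable_fun setT bump.
Proof. by apply: measurable_maxr => //; apply: measurable_funB => //; exact: measurable_funX. Qed.

Lemma bump_prod0 v w : 1 <= v ^+ 2 + w ^+ 2 -> bump (v - w) * bump (v + w) = 0.
Proof.
move=> vw; have [h|/ltW h] := leP 1 ((v - w) ^+ 2); first by rewrite bump0// mul0r.
by rewrite [bump (v + w)]bump0 ?mulr0//; nra.
Qed.

Let profile_prod j v w : profile j (v - w) * profile j (v + w) =
  (v ^+ 2 - w ^+ 2) ^+ j * (bump (v - w) * bump (v + w)) ^+ 2.
Proof. by rewrite /profile mulrACA -!exprMn; congr (_ ^+ j * _); ring. Qed.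

(** If 1 <= |v|, one of v - w and v + w is outside the support as well: the
    error is supported in |v| <= 1 for every w. *)
Lemma profile_error_outside j v w : 1 <= v ^+ 2 -> profile_error j v w = 0.
Proof.
move=> v1; have := sqr_ge0 w => w0.
rewrite /profile_error profile_prod bump_prod0; last by lra.
by rewrite /profile_coef0 /profile_coef2 bump0//; ring.
Qed.

Let error_offsupport j v w : (j <= 1)%N -> v ^+ 2 <= 1 ->
  bump (v - w) * bump (v + w) = 0 ->
  profile_error j v w = (1 - v ^+ 2) ^+ 2 *
    (4 * (v ^+ 2) ^+ j * (1 + v ^+ 2) * w ^+ 2 +
     (j%:R * w ^+ 2 - (v ^+ 2) ^+ j) * (1 - v ^+ 2) ^+ 2).
Proof.
move=> j1 v1 vw; rewrite /profile_error profile_prod vw.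
rewrite /profile_coef0 /profile_coef2 bumpE//.
by case: j j1 => [|[|//]] _; ring.
Qed.

Let error_onsupport j v w : (j <= 1)%N -> v ^+ 2 <= 1 ->
  (v - w) ^+ 2 <= 1 -> (v + w) ^+ 2 <= 1 ->
  profile_error j v w = (w ^+ 2) ^+ 2 *
    ((v ^+ 2 - w ^+ 2) ^+ j *
       (2 * (1 - v ^+ 2) ^+ 2 + (2 * (1 + v ^+ 2) - w ^+ 2) ^+ 2) +
     j%:R * (4 * (1 - v ^+ 2) ^+ 2 * (1 + v ^+ 2))).
Proof.
move=> j1 v1 vw1 vw2; rewrite /profile_error profile_prod.
rewrite /profile_coef0 /profile_coef2 !bumpE//.
by case: j j1 => [|[|//]] _; ring.
Qed.

Let offsupport_le j (V W P c : R) : (j <= 1)%N -> 0 <= V <= 1 -> 0 <= W ->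
  0 <= P <= 1 -> P <= c * W -> 9 <= c ->
  `|4 * V ^+ j * (1 + V) * W + (j%:R * W - V ^+ j) * P| <= c * W.
Proof.
move=> j1 /andP[V0 V1] W0 /andP[P0 P1] PcW c9.
have E0 : 0 <= V ^+ j by rewrite exprn_ge0.
have E1 : V ^+ j <= 1 by rewrite exprn_ile1.
have J0 : 0 <= j%:R :> R by [].
have J1 : j%:R <= 1 :> R by rewrite lern1.
move: (V ^+ j) (j%:R : R) E0 E1 J0 J1 => E J E0 E1 J0 J1.
have EV : E * (1 + V) <= 2 by nra.
have EV0 : 0 <= E * (1 + V) by rewrite mulr_ge0// addr_ge0.
have X1 : E * (1 + V) * W <= 2 * W by rewrite ler_wpM2r.
have X0 : 0 <= E * (1 + V) * W by rewrite mulr_ge0.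
have EP0 : 0 <= E * P by rewrite mulr_ge0.
have EP1 : E * P <= P by rewrite ler_piMl.
have JP0 : 0 <= J * P by rewrite mulr_ge0.
have JP1 : J * P <= 1 by rewrite mulr_ile1.
have Y0 : 0 <= J * P * W by rewrite mulr_ge0.
have Y1 : J * P * W <= W by rewrite ler_piMl.
have cW : 9 * W <= c * W by rewrite ler_wpM2r.
by rewrite ler_norml; apply/andP; split; lra.
Qed.

(** Where the product is nonzero this is the remainder of a polynomial
    identity. Elsewhere 1 - v ^ 2 = O(w), and the two coefficients are small
    because they contain the second power of [bump]. *)
Lemma profile_error_quartic j v w : (j <= 1)%N -> w ^+ 2 <= 1 ->
  `|profile_error j v w| <= 64 * w ^+ 4.
Proof.
move=> j1 w1; rewrite (_ : w ^+ 4 = (w ^+ 2) ^+ 2); last by ring.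
have [v1|v1] := leP 1 (v ^+ 2).
  by rewrite profile_error_outside// normr0 mulr_ge0// sqr_ge0.
have V0 := sqr_ge0 v; have W0 := sqr_ge0 w.
have [/andP[vw1 vw2]|vw] := boolP ((((v - w) ^+ 2) <= 1) && (((v + w) ^+ 2) <= 1)).
  rewrite error_onsupport ?(ltW v1)//.
  move: (v ^+ 2) (w ^+ 2) v1 V0 W0 w1 {vw1 vw2} => V W V1 V0 W0 W1.
  rewrite normrM mulrC (ger0_norm (sqr_ge0 W)) ler_wpM2r ?sqr_ge0//.
  have P1 : 0 <= (1 - V) ^+ 2 <= 1 by rewrite sqr_ge0/=; nra.
  have M1 : 0 <= (2 * (1 + V) - W) ^+ 2 <= 16 by rewrite sqr_ge0/=; nra.
  move: ((1 - V) ^+ 2) ((2 * (1 + V) - W) ^+ 2) P1 M1 => P M /andP[P0 P1] /andP[M0 M1].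
  case: j j1 => [|[|//]] _; rewrite ?expr0 ?expr1 ler_norml; apply/andP; split; nra.
have prod0 : bump (v - w) * bump (v + w) = 0.
  move: vw; rewrite negb_and -!ltNge => /orP[] h.
    by rewrite bump0 ?mul0r// ltW.
  by rewrite [bump (v + w)]bump0 ?mulr0// ltW.
(* One of |v - w|, |v + w| exceeds 1, so 1 - |v| <= |w|. *)
have P4 : (1 - v ^+ 2) ^+ 2 <= 4 * w ^+ 2.
  have nv : `|v| <= 1 by rewrite -(expr_le1 (n := 2))// real_normK ?num_real// ltW.
  have nvw : 1 <= `|v| + `|w|.
    move: vw; rewrite negb_and -!ltNge => /orP[] h.
      have := ler_normB v w; have : 1 < `|v - w|.
        by rewrite -(expr_gt1 (n := 2))// real_normK ?num_real.
      by lra.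
    have := ler_normD v w; have : 1 < `|v + w|.
      by rewrite -(expr_gt1 (n := 2))// real_normK ?num_real.
    by lra.
  rewrite -(real_normK (num_real v)) -(real_normK (num_real w)).
  have := normr_ge0 v; move: (`|v|) (`|w|) nv nvw => a b a1 ab a0.
  have -> : 4 * b ^+ 2 = (2 * b) ^+ 2 by ring.
  by rewrite lerXn2r ?nnegrE//; nra.
rewrite error_offsupport ?(ltW v1)//.
move: (v ^+ 2) (w ^+ 2) v1 V0 W0 w1 P4 {vw prod0} => V W V1 V0 W0 W1.
have P01 : 0 <= (1 - V) ^+ 2 <= 1 by rewrite sqr_ge0/=; nra.
move: ((1 - V) ^+ 2) P01 => P /andP[P0 P1] P4.
rewrite normrM ger0_norm//.
apply: (@le_trans _ _ (4 * W * (12 * W))); last by nra.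
apply: ler_pM => //; apply: offsupport_le; rewrite ?V0 ?P0 ?(ltW V1)//; lra.
Qed.

(** For 1 <= |w| the product vanishes and only the coefficients remain. *)
Lemma profile_error_quadratic j v w : (j <= 1)%N -> 1 <= w ^+ 2 ->
  `|profile_error j v w| <= 10 * w ^+ 2.
Proof.
move=> j1 w1; have V0 := sqr_ge0 v; have W0 := sqr_ge0 w.
have [v1|v1] := leP 1 (v ^+ 2).
  by rewrite profile_error_outside// normr0 mulr_ge0.
rewrite error_offsupport ?(ltW v1)//; last by rewrite bump_prod0//; lra.
move: (v ^+ 2) (w ^+ 2) v1 V0 W0 w1 => V W V1 V0 W0 W1.
have P01 : 0 <= (1 - V) ^+ 2 <= 1 by rewrite sqr_ge0/=; nra.
move: ((1 - V) ^+ 2) P01 => P /andP[P0 P1].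
rewrite normrM ger0_norm// -[leRHS]mul1r; apply: ler_pM => //.
by apply: offsupport_le; rewrite ?V0 ?P0 ?(ltW V1)//; lra.
Qed.

End trial_profile.

(** * Rescaled trial functions *)

Section trial_functions.
Context {R : realType}.
Local Notation leb := (@lebesgue_measure R).

Lemma Rintegral_norm_le (q : R -> R) (b : R) (D : set R) : measurable D ->
  bounded_set D -> test_function q -> (forall x, `|q x| <= b) ->
  (forall x, ~ D x -> q x = 0) -> \int[leb]_x `|q x| <= b * fine (leb D).
Proof.
move=> mD bD tq qb qD.
have tD := test_function_monomial 0 mD bD.
have Di := test_function_integrable_lebesgue tD.
have -> : fine (leb D) = \int[leb]_x (x ^+ 0 * \1_D x).
  under eq_Rintegral do rewrite expr0 mul1r.
  by rewrite /Rintegral integral_indic// setIT.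
rewrite -RintegralZl//; apply: le_Rintegral => //.
- exact: integrable_norm (test_function_integrable_lebesgue tq).
- exact: (integrableZl _ b Di).
- move=> x _; rewrite expr0 mul1r indicE; case: (boolP (x \in D)) => [_|xD].
    by rewrite mulr1.
  by rewrite qD ?normr0 ?mulr0//; move: xD; rewrite notin_setE.
Qed.

(** Equal to [x ^+ j] up to a relative error of order [(x / r) ^+ 2]. *)
Definition trial (j : nat) (r x : R) : R := r ^+ j * profile j (r^-1 * x).

Lemma measurable_scaled (q : R -> R) (r : R) : measurable_fun setT q ->
  measurable_fun setT (fun x : R => q (r^-1 * x)).
Proof. by move=> mq; apply: (measurableT_comp mq); exact: measurable_funM. Qed.

Lemma test_function_scaled (q : R -> R) (b c r : R) : 0 < r ->
  measurable_fun setT q -> (forall v, v ^+ 2 <= 1 -> `|q v| <= b) ->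
  (forall v, 1 <= v ^+ 2 -> q v = 0) ->
  test_function (fun x => c * q (r^-1 * x)).
Proof.
move=> r0 mq qb q0; apply/test_functionP; split.
  by apply: measurable_funM => //; exact: measurable_scaled.
have b0 : 0 <= b by apply: le_trans (qb 0 _); rewrite ?expr0n.
exists (`|c| * b), r => x; split.
  rewrite normrM ler_wpM2l//; have [v1|/ltW v1] := leP ((r^-1 * x) ^+ 2) 1.
    exact: qb.
  by rewrite q0// normr0.
move=> rx; rewrite q0 ?mulr0// -[_ ^+ 2]real_normK ?num_real//.
rewrite exprn_ege1// normrM gtr0_norm ?invr_gt0//.
by rewrite ler_pdivlMl// mulr1 ltW.
Qed.

Section fixed_scale.
Variables (j : nat) (r : R).
Hypothesis r0 : 0 < r.

Let bump_normX (v : R) (n : nat) : `|bump v ^+ n| <= 1.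
Proof. by rewrite ger0_norm ?exprn_ge0 ?bump_ge0// exprn_ile1 ?bump_ge0 ?bump_le1. Qed.

Lemma test_function_trial : test_function (trial j r).
Proof.
apply: (@test_function_scaled _ 1) => //.
- by apply: measurable_funM; [exact: measurable_funX|apply: measurable_funX; exact: measurable_bump].
- move=> v v1; rewrite /profile normrM mulr_ile1// normrX exprn_ile1//.
  by rewrite -(expr_le1 (n := 2))// real_normK ?num_real.
- by move=> v v1; rewrite /profile bump0// expr0n mulr0.
Qed.

Lemma test_function_coef0 :
  test_function (fun y => r ^+ (2 * j) * profile_coef0 j (r^-1 * y)).
Proof.
apply: (@test_function_scaled _ 1) => //.
- apply: measurable_funM; last by apply: measurable_funX; exact: measurable_bump.
  by do 2 apply: measurable_funX.
- move=> v v1; rewrite /profile_coef0 normrM mulr_ile1//.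
  have := exprn_ile1 j (sqr_ge0 v) v1; have := exprn_ge0 j (sqr_ge0 v).
  by move=> V0 V1; rewrite ger0_norm.
- by move=> v v1; rewrite /profile_coef0 bump0// expr0n mulr0.
Qed.

Lemma test_function_coef2 :
  test_function (fun y => r ^+ (2 * j) / r ^+ 2 * profile_coef2 j (r^-1 * y)).
Proof.
apply: (@test_function_scaled _ (8 + j%:R)) => //.
- apply: measurableT_comp => //; apply: measurable_funD.
    apply: measurable_funM; last by apply: measurable_funX; exact: measurable_bump.
    apply: measurable_funM; last by apply: measurable_funD => //; exact: measurable_funX.
    by apply: measurable_funM => //; do 2 apply: measurable_funX.
  by apply: measurable_funM => //; apply: measurable_funX; exact: measurable_bump.
- move=> v v1; rewrite /profile_coef2 normrN (le_trans (ler_normD _ _))// lerD//.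
    have E1 := exprn_ile1 j (sqr_ge0 v) v1; have E0 := exprn_ge0 j (sqr_ge0 v).
    have V0 := sqr_ge0 v.
    have := bump_normX v 2; rewrite ger0_norm ?sqr_ge0// => P1.
    have P0 := sqr_ge0 (bump v); rewrite ger0_norm; last first.
      by apply: mulr_ge0 => //; apply: mulr_ge0; [apply: mulr_ge0|apply: addr_ge0].
    move: (v ^+ 2) ((v ^+ 2) ^+ j) (bump v ^+ 2) v1 V0 E0 E1 P0 P1.
    move=> V E P V1 V0 E0 E1 P0 P1.
    have EV1 : E * (1 + V) <= 2 by nra.
    have EV0 : 0 <= E * (1 + V) by rewrite mulr_ge0// addr_ge0.
    by have := ler_piMr EV0 P1; lra.
  by rewrite normrM normr_nat -[leRHS]mulr1 ler_wpM2l.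
- by move=> v v1; rewrite /profile_coef2 bump0// !expr0n/= !mulr0 addr0 oppr0.
Qed.

Definition trial_mass := \int[leb]_y (r ^+ (2 * j) * profile_coef0 j (r^-1 * y)).

Definition trial_curvature :=
  \int[leb]_y (r ^+ (2 * j) / r ^+ 2 * profile_coef2 j (r^-1 * y)).

(** The shift of the integration variable by u makes the integrand symmetric
    in u, which is what removes the odd orders of its expansion. *)
Lemma autocorr_trialE u : exists2 q, test_function q &
  (forall y, q y = r ^+ (2 * j) * profile_error j (r^-1 * y) (r^-1 * u)) /\
  autocorr (trial j r) (2 * u) - trial_mass - trial_curvature * u ^+ 2 =
    \int[leb]_y q y.
Proof.
have tg := test_function_trial.
have tp : test_function (fun y => trial j r (- u + y) * trial j r (u + y)).
  by apply: test_functionM; exact: test_function_shift.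
have t0 := test_function_coef0; have t2 := test_function_coef2.
have i2 := test_function_integrable_lebesgue t2.
have tq0 := test_functionB tp t0.
pose k2 y := u ^+ 2 * (r ^+ (2 * j) / r ^+ 2 * profile_coef2 j (r^-1 * y)).
have t2u : test_function k2.
  have := test_function_coef2; rewrite /k2.
  move=> /test_functionP[m2 [b [s bs]]]; apply/test_functionP; split.
    exact: measurable_funM.
  exists (`|u ^+ 2| * b), s => y; split.
    by rewrite normrM ler_wpM2l// (bs y).1.
  by move=> /(bs y).2 ->; rewrite mulr0.
exists (fun y => trial j r (- u + y) * trial j r (u + y) -
  r ^+ (2 * j) * profile_coef0 j (r^-1 * y) - k2 y).
  exact: test_functionB.
split=> [y|].
  rewrite /k2 /profile_error /trial.
  have -> : r^-1 * (- u + y) = r^-1 * y - r^-1 * u by ring.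
  have -> : r^-1 * (u + y) = r^-1 * y + r^-1 * u by ring.
  rewrite mul2n -addnn exprD exprMn exprVn; ring.
rewrite RintegralB//; [|exact: test_function_integrable_lebesgue..].
rewrite RintegralB//; [|exact: test_function_integrable_lebesgue..].
rewrite [X in _ = _ - X](_ : _ = trial_curvature * u ^+ 2); last first.
  by rewrite /k2 RintegralZl// mulrC.
congr (_ - _ - _).
rewrite /autocorr -[LHS](Rintegral_shift (- u)).
  by apply: eq_Rintegral => y _; congr (trial _ _ _ * trial _ _ _); ring.
exact: autocorr_integrand_integrable.
Qed.

Lemma autocorr_trial_error u b : (j <= 1)%N ->
  (forall v, `|r ^+ (2 * j) * profile_error j v (r^-1 * u)| <= b) ->
  `|autocorr (trial j r) (2 * u) - trial_mass - trial_curvature * u ^+ 2|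
    <= b * (2 * r).
Proof.
move=> j1 eb; have [q tq [qE ->]] := autocorr_trialE u.
have qi := test_function_integrable_lebesgue tq.
rewrite (le_trans (le_normr_Rintegral _ qi))//.
have -> : 2 * r = fine (leb `[- r, r]%classic).
  rewrite lebesgue_measure_itv/= lte_fin ifT ?opprK//=; first by ring.
  by rewrite -subr_gt0 opprK addr_gt0.
apply: Rintegral_norm_le => //.
- exact: bounded_set_itvcc.
- by move=> y; rewrite qE.
move=> y /=; rewrite in_itv/= -ler_norml => /negP; rewrite -ltNge => ry.
rewrite qE profile_error_outside ?mulr0// -[_ ^+ 2]real_normK ?num_real//.
rewrite exprn_ege1// normrM gtr0_norm ?invr_gt0//.
by rewrite ler_pdivlMl// mulr1 ltW.
Qed.

End fixed_scale.

(** The error is at most r ^ 2 * 64 * (x / (2 r)) ^ 4 on an interval of length 2 r;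
    the factor r ^ 2 is the worst case j = 1. *)
Lemma autocorr_trial_small j (r x : R) : (j <= 1)%N -> 1 <= r -> `|x| <= 2 * r ->
  `|autocorr (trial j r) x - trial_mass j r - trial_curvature j r / 4 * x ^+ 2|
    <= 8 * x ^+ 4 / r.
Proof.
move=> j1 r1 xr; have r0 : 0 < r by lra.
have rj : r ^+ (2 * j) <= r ^+ 2.
  by rewrite ler_weXn2l// -[leqRHS]muln1 leq_mul2l.
have := @autocorr_trial_error j r r0 (x / 2) (4 * x ^+ 4 / r ^+ 2) j1 _.
have -> : 2 * (x / 2) = x by field.
have -> : trial_curvature j r * (x / 2) ^+ 2 = trial_curvature j r / 4 * x ^+ 2 by field.
have -> : 4 * x ^+ 4 / r ^+ 2 * (2 * r) = 8 * x ^+ 4 / r.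
  by field; rewrite gt_eqF.
apply=> v; rewrite normrM (ger0_norm (exprn_ge0 _ (ltW r0))).
have u1 : (r^-1 * (x / 2)) ^+ 2 <= 1.
  have hx : `|x / 2| <= r.
    by rewrite normrM [`|2^-1|]gtr0_norm// ler_pdivrMr// mulrC.
  rewrite -[_ ^+ 2]real_normK ?num_real// exprn_ile1// normrM gtr0_norm ?invr_gt0//.
  by rewrite ler_pdivrMl// mulr1.
have x40 : 0 <= x ^+ 4 by rewrite exprn_even_ge0.
apply: (@le_trans _ _ (r ^+ 2 * (64 * (r^-1 * (x / 2)) ^+ 4))).
  by apply: ler_pM => //; [exact: exprn_ge0 (ltW r0)|exact: profile_error_quartic].
by rewrite le_eqVlt; apply/orP; left; apply/eqP; field; rewrite gt_eqF.
Qed.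

(** Beyond |x| = 2 r the quadratic bound of the error takes over; both regimes
    are dominated by the same cubic function, independently of r. *)
Lemma autocorr_trial_cubic j (r x : R) : (j <= 1)%N -> 1 <= r ->
  `|autocorr (trial j r) x - trial_mass j r - trial_curvature j r / 4 * x ^+ 2|
    <= 16 * `|x| ^+ 3.
Proof.
move=> j1 r1; have r0 : 0 < r by lra.
have [xr|/ltW xr] := leP (`|x|) (2 * r).
  rewrite (le_trans (autocorr_trial_small j1 r1 xr))// ler_pdivrMr//.
  have -> : x ^+ 4 = `|x| ^+ 4 by rewrite -normrX ger0_norm// exprn_even_ge0.
  rewrite (_ : 8 * `|x| ^+ 4 = 8 * `|x| ^+ 3 * `|x|); last by ring.
  rewrite (_ : 16 * `|x| ^+ 3 * r = 8 * `|x| ^+ 3 * (2 * r)); last by ring.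
  by rewrite ler_wpM2l// mulr_ge0// exprn_ge0.
have rj : r ^+ (2 * j) <= r ^+ 2.
  by rewrite ler_weXn2l// -[leqRHS]muln1 leq_mul2l.
have := @autocorr_trial_error j r r0 (x / 2) (5 / 2 * x ^+ 2) j1 _.
have -> : 2 * (x / 2) = x by field.
have -> : trial_curvature j r * (x / 2) ^+ 2 = trial_curvature j r / 4 * x ^+ 2 by field.
move=> h; apply: le_trans (h _) _ => [v|]; last first.
  rewrite -[x ^+ 2]real_normK ?num_real//.
  have x2 : 0 <= `|x| ^+ 2 by rewrite exprn_ge0.
  apply: (@le_trans _ _ (5 / 2 * `|x| ^+ 2 * `|x|)).
    by rewrite ler_wpM2l// mulr_ge0.
  have x3 : 0 <= `|x| ^+ 3 by rewrite exprn_ge0.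
  by rewrite (_ : 5 / 2 * `|x| ^+ 2 * `|x| = 5 / 2 * `|x| ^+ 3); [lra|ring].
rewrite normrM (ger0_norm (exprn_ge0 _ (ltW r0))).
apply: (@le_trans _ _ (r ^+ 2 * (10 * (r^-1 * (x / 2)) ^+ 2))).
  apply: ler_pM => //; first exact: exprn_ge0 (ltW r0).
  apply: profile_error_quadratic => //.
  have hx : r <= `|x / 2|.
    by rewrite normrM [`|2^-1|]gtr0_norm// ler_pdivlMr// mulrC.
  rewrite -[_ ^+ 2]real_normK ?num_real// exprn_ege1// normrM gtr0_norm ?invr_gt0//.
  by rewrite ler_pdivlMl// mulr1.
by rewrite le_eqVlt; apply/orP; left; apply/eqP; field; rewrite gt_eqF.
Qed.

Lemma trial_near (j : nat) (r M x : R) : 0 < r -> `|x| <= M -> M <= r ->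
  `|x ^+ j - trial j r x| <= 2 * M ^+ j.+2 / r ^+ 2.
Proof.
move=> r0 xM Mr; have M0 : 0 <= M := le_trans (normr_ge0 x) xM.
have v1 : (r^-1 * x) ^+ 2 <= 1.
  rewrite -[_ ^+ 2]real_normK ?num_real// exprn_ile1// normrM gtr0_norm ?invr_gt0//.
  by rewrite ler_pdivrMl// mulr1 (le_trans xM).
rewrite /trial /profile bumpE// mulrA -exprMn mulVKf ?gt_eqF//.
rewrite -{1}[x ^+ j]mulr1 -mulrBr normrM normrX.
rewrite (_ : 2 * M ^+ j.+2 / r ^+ 2 = M ^+ j * (2 * (r^-1 * M) ^+ 2)); last first.
  have -> : M ^+ j.+2 = M ^+ j * M ^+ 2 by rewrite -exprD addn2.
  by field; rewrite gt_eqF.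
apply: ler_pM => //; first by rewrite lerXn2r// ?nnegrE.
apply: (@le_trans _ _ (2 * (r^-1 * x) ^+ 2)).
  have := sqr_ge0 (r^-1 * x); move: ((r^-1 * x) ^+ 2) v1 => V V1 V0.
  by rewrite ler_norml; apply/andP; split; nra.
rewrite ler_wpM2l// -[leLHS]real_normK ?num_real// lerXn2r ?nnegrE ?mulr_ge0 ?invr_ge0 ?(ltW r0)//.
by rewrite normrM gtr0_norm ?invr_gt0// ler_wpM2l// invr_ge0 ltW.
Qed.

End trial_functions.

(** * Rigidity *)

Section rigidity.
Context {R : realType} {d : measure_display} {Omega : measurableType d}.
Variables (Pr : probability Omega R) (P : R.-ker Omega ~> measurableTypeR R).
Variable C : signed_radon_measure R.
Local Notation tv := (srm_total_variation C).
Local Notation leb := (@lebesgue_measure R).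
Hypothesis moment3 : (\int[tv]_t (`|t| ^+ 3)%:E < +oo)%E.
Hypothesis mass0 : sint C (cst 1) = 0.
Hypothesis moment2 : sint C (fun t => t ^+ 2) = 0.

Lemma trial_energy_cvg j : (j <= 1)%N ->
  energy C (trial j n.+1%:R) @[n --> \oo] --> (0 : R).
Proof.
move=> j1.
have c1i (c : R) : tv.-integrable setT (EFin \o cst c).
  by apply: (@tv_integrable_bounded _ _ moment3 _ `|c|).
have sqi := tv_integrable_square moment3.
have tg n : test_function (@trial R j n.+1%:R) by exact: test_function_trial.
have gi n := (autocorr_correlation moment3 (tg n)).1.
pose err (n : nat) (x : R) := autocorr (trial j n.+1%:R) x -
  trial_mass j n.+1%:R - trial_curvature j n.+1%:R / 4 * x ^+ 2.
have massi n : tv.-integrable setT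
    (EFin \o (fun x => autocorr (trial j n.+1%:R) x - trial_mass j n.+1%:R)).
  exact: (integrableB measurableT (gi n) (c1i _)).
have curvi n : tv.-integrable setT
    (EFin \o (fun x => trial_curvature j n.+1%:R / 4 * x ^+ 2)).
  exact: (integrableZl measurableT (trial_curvature j n.+1%:R / 4) sqi).
have erri n : tv.-integrable setT (EFin \o err n).
  exact: (integrableB measurableT (massi n) (curvi n)).
have energyE n : energy C (trial j n.+1%:R) = sint C (err n).
  rewrite (sintB (massi n) (curvi n)) (sintB (gi n) (c1i (trial_mass j n.+1%:R))).
  rewrite sintZ// moment2 mulr0 subr0.
  rewrite (_ : cst (trial_mass j n.+1%:R) = fun x => trial_mass j n.+1%:R * cst 1 x).
    by rewrite sintZ// mass0 mulr0 subr0.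
  by apply/funext => x; rewrite mulr1.
have n1 n : 1 <= n.+1%:R :> R by rewrite ler1n.
have err_cvg x : err n x @[n --> \oo] --> (0 : R).
  apply/norm_cvg0P; apply: (@squeeze_cvgr _ _ _ _ (cst 0) (fun n => 8 * x ^+ 4 * n.+1%:R^-1)).
  - exists (Num.truncn `|x|).+1 => // n /= xn; rewrite normr_ge0/=.
    apply: autocorr_trial_small => //.
    have /andP[_ h] := truncn_itv (normr_ge0 x).
    have : (Num.truncn `|x|).+1%:R <= n.+1%:R :> R by rewrite ler_nat (leq_trans xn).
    by have := n1 n; lra.
  - exact: cvg_cst.
  - rewrite -[X in _ --> X](mulr0 (8 * x ^+ 4)); apply: cvgM; first exact: cvg_cst.
    exact: cvg_harmonic.
have [] := @dominated_convergence _ _ _ tv _ measurableT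
  (fun n => EFin \o err n) (cst 0%E) (fun x => (16 * `|x| ^+ 3)%:E).
- by move=> n; exact: measurable_int (erri n).
- exact: measurable_cst.
- by apply: aeW => x _; apply: cvg_EFin; [exact: nearW|exact: err_cvg].
- apply: (@tv_integrable_cubic _ _ moment3 (fun x => 16 * `|x| ^+ 3) 16).
    by apply: measurable_funM => //; apply: measurable_funX; exact: normr_measurable.
  move=> t; rewrite ger0_norm ?mulr_ge0 ?exprn_ge0// ler_wpM2l//.
  by rewrite lerDr.
- by apply: aeW => x n _ /=; rewrite lee_fin; exact: autocorr_trial_cubic.
move=> _ norm_cvg _.
apply/norm_cvg0P.
apply: (@squeeze_cvgr _ _ _ _ (cst 0) (fun n => \int[tv]_x `|err n x|)).
- by apply: nearW => n; rewrite normr_ge0/= energyE; exact: le_normr_sint.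
- exact: cvg_cst.
move/fine_cvg: norm_cvg; apply: cvg_trans; apply: near_eq_cvg; apply: nearW => n /=.
by congr fine; apply: eq_integral => x _; rewrite /= subr0.
Qed.

Hypotheses (Ppp : point_process P).
Hypothesis Pcorr : correlation_measure Pr P C.

(** The statistic of g + e, with e the correction of g on A, is exactly of the
    form I(gamma_j) - I(h): it has the values of x ^ j on A, and of -h off A. *)
Lemma rigid_of_vanishing_moments (A : set R) : measurable A -> bounded_set A ->
  linearly_rigid Pr P 1 A.
Proof.
move=> mA bA j j1; apply/eqP; rewrite eq_le; apply/andP; split; last first.
  by apply: le_ereal_inf_tmp => _ [h _ <-]; exact: variance_ge0.
have [M M1 AM] : exists2 M, 1 <= M & forall x, A x -> `|x| <= M.
  have [M [_ AM]] := bA; exists (`|M| + 1); first by rewrite lerDr.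
  by move=> x Ax; apply: AM Ax; rewrite ltr_pwDr// ler_norm.
have M0 : 0 <= M by lra.
pose b (n : nat) : R := 2 * M ^+ j.+2 / n.+1%:R ^+ 2.
pose T := fine (tv setT); pose a := fine (leb A).
pose bound (n : nat) : R := 2 * (energy C (trial j n.+1%:R) + b n * (b n * a) * T).
have bound_cvg : bound n @[n --> \oo] --> (0 : R).
  have b_cvg : b n @[n --> \oo] --> (0 : R).
    rewrite -[X in _ --> X](mulr0 (2 * M ^+ j.+2)).
    rewrite /b; apply: cvgM; first exact: cvg_cst.
    rewrite -[X in _ --> X](mulr0 (0 : R)).
    under eq_fun do rewrite expr2 invfM.
    by apply: cvgM; exact: cvg_harmonic.
  rewrite -[X in _ --> X](mulr0 2) /bound; apply: cvgM; first exact: cvg_cst.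
  rewrite -[X in _ --> X](addr0 0); apply: cvgD; first exact: trial_energy_cvg.
  rewrite [X in _ --> X](_ : 0 = 0 * (0 * a) * T); last by rewrite !mul0r.
  apply: cvgM; last exact: cvg_cst.
  by apply: cvgM => //; apply: cvgM => //; exact: cvg_cst.
set I := ereal_inf _.
have inf_le n : M <= n.+1%:R -> (I <= (bound n)%:E)%E.
  move=> Mn; pose g : R -> R := trial j n.+1%:R.
  have tg : test_function g by exact: test_function_trial.
  have tm := test_function_monomial j mA bA.
  pose h x := - (g x * \1_(~` A) x).
  have th : test_function h.
    by apply: test_functionN; apply: test_function_restrict => //; exact: measurableC.
  pose e x := x ^+ j * \1_A x - g x * \1_A x.
  have te : test_function e by apply: test_functionB => //; exact: test_function_restrict.
  have ghe x : x ^+ j * \1_A x - h x = g x + e x.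
    by rewrite /h /e indicC !indicE; case: (x \in A); rewrite /=; ring.
  apply: (@le_trans _ _ ('V_Pr[linstat P (fun x => g x + e x)%R])%E).
    apply: ereal_inf_lbound; exists h.
      split=> // x xA; by rewrite /h indicE in_setC xA mulr0 oppr0.
    congr (variance Pr _); apply/funext => w.
    rewrite /= -(linstatB Ppp w tm th); congr (linstat P _ w).
    by apply/funext => x; exact: ghe.
  have tge := test_functionD tg te.
  rewrite (variance_energy Pcorr moment3 tge) lee_fin.
  apply: le_trans (energyD_le Pcorr moment3 tg te) _.
  rewrite ler_wpM2l// lerD2l.
  have b0 : 0 <= b n.
    by apply: divr_ge0; [apply: mulr_ge0 => //; exact: exprn_ge0|exact: exprn_ge0].
  have eb x : `|e x| <= b n.
    rewrite /e -mulrBl indicE; case: (boolP (x \in A)) => [/set_mem Ax|_].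
      by rewrite mulr1; apply: trial_near => //; exact: AM.
    by rewrite mulr0 normr0.
  apply: le_trans (energy_le moment3 te eb) _.
  rewrite ler_wpM2r ?fine_ge0// ler_wpM2l//.
  apply: Rintegral_norm_le => // x Ax.
  by rewrite /e indicE memNset//= !mulr0 subr0.
have boundE : (bound n)%:E @[n --> \oo] --> 0%E.
  by apply: cvg_EFin; [exact: nearW|exact: bound_cvg].
rewrite -(cvg_lim (@ereal_hausdorff _) boundE); apply: lime_ge.
  by apply/cvg_ex; exists 0%E.
exists (Num.truncn M).+1 => // n /= Mn; apply: inf_le.
have /andP[_ h] := truncn_itv M0.
by rewrite (le_trans (ltW h))// ler_nat (leq_trans Mn).
Qed.

End rigidity.

Theorem corollary6 (R : realType) (d : measure_display)
    (Omega : measurableType d) (Pr : probability Omega R)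
    (P : R.-ker Omega ~> measurableTypeR R) (C : signed_radon_measure R)
    (A : set R) :
  point_process P ->
  stationary Pr P ->
  locally_square_integrable Pr P ->
  correlation_measure Pr P C ->
  hyperuniform Pr P ->
  measurable A -> bounded_set A -> ~ linearly_rigid Pr P 1 A ->
  (\int[srm_total_variation C]_t (`|t| ^+ 3)%:E = +oo)%E \/
  srm_integral C (fun t => t ^+ 2) <> 0%E.
Proof.
move=> Ppp Pst Psq Pcorr Phyp mA bA nrigid.
have [->|moment3] := eqVneq (\int[srm_total_variation C]_t (`|t| ^+ 3)%:E)%E +oo%E.
  by left.
right=> moment2; apply: nrigid.
have {}moment3 : (\int[srm_total_variation C]_t (`|t| ^+ 3)%:E < +oo)%E.
  by rewrite ltey.
apply: (rigid_of_vanishing_moments moment3) => //.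
  exact: (total_mass_eq0 Ppp Pst Psq Pcorr moment3 Phyp).
rewrite srm_integralE in moment2; first by case: moment2.
exact: tv_integrable_square.
Qed.
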